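(* Let $G$ be a countable discrete group and let $H\in \mathrm{Sub}_{\rm sg}(G)$, i.e. $H$ is a subgroup of $G$ with the spectral gap property. Let $L$ be a self-commensurating subgroup of $G$. Then the quasi-regular representations $\lambda_{G/H}$ and $\lambda_{G/L}$ are weakly equivalent if and only if $L$ is conjugate to $H$ in $G$.
   Context: $\lambda_{G/H}$ denotes the quasi-regular representation of $G$ on $\ell^2(G/H)$ (by left translation). Every unitary representation of $G$ is extended to the maximal $C^*$-algebra $C^*(G)$. A unitary representation $\rho$ is weakly contained in $\pi$, written $\rho\prec\pi$, if $\|\rho(x)\|\le\|\pi(x)\|$ for all $x\in C^*(G)$; $\rho$ and $\pi$ are weakly equivalent if $\rho\prec\pi$ and $\pi\prec\rho$. An action of a group $\Gamma$ on a set $X$ has a spectral gap if the associated natural unitary representation of $\Gamma$ on $\ell^2(X)$ does not weakly contain the trivial representation $1_\Gamma$. A subgroup $H$ of $G$ has the spectral gap property if the action by left translation of $H$ on $X=G/H\setminus\{H\}$ has a spectral gap. $\mathrm{Sub}_{\rm sg}(G)$ is the set of all such subgroups. The commensurator of a subgroup $L$ in $G$ is the set of $g\in G$ such that $gLg^{-1}\cap L$ has finite index in both $L$ and $gLg^{-1}$; $L$ is self-commensurating if its commensurator equals $L$. *)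

(* Defs.v *)
From HB Require Import structures.
From mathcomp Require Import all_boot all_order all_algebra finmap.
From mathcomp Require Import all_classical all_reals all_analysis.
From mathcomp Require Import complex.
From mathcomp Require Import ring lra.

Set Implicit Arguments.
Unset Strict Implicit.
Unset Printing Implicit Defensive.

Import Order.TTheory GRing.Theory Num.Theory.
Import numFieldNormedType.Exports.

Local Open Scope classical_set_scope.
Local Open Scope ring_scope.

Section sums.
Variables (R : realType) (X : choiceType).
Implicit Types (f g : X -> R).

Definition rsummable f := summable [set: X] (EFin \o f).

(* The unconditional sum of f over X; meaningful only when f is summable. *)
Definition rsum f : R :=
  fine (\esum_(x in [set: X]) ((EFin \o f)^\+)%E x) -
  fine (\esum_(x in [set: X]) ((EFin \o f)^\-)%E x).

Lemma rsummableE f :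
  rsummable f = (\esum_(x in [set: X]) (`|f x|)%:E < +oo)%E.
Proof. by []. Qed.

Lemma rsummable_le f g :
  (forall x, `|f x| <= g x) -> rsummable g -> rsummable f.
Proof.
move=> fg; rewrite !rsummableE; apply: le_lt_trans; apply: le_esum => x _.
by rewrite lee_fin; exact: le_trans (fg x) (ler_norm _).
Qed.

Lemma rsummableD f g :
  rsummable f -> rsummable g -> rsummable (fun x => f x + g x).
Proof.
move=> sf sg; rewrite rsummableE.
apply: le_lt_trans (lte_add_pinfty sf sg).
rewrite -esumD//; apply: le_esum => x _.
by rewrite /= -EFinD lee_fin ler_normD.
Qed.

Lemma esumZl (c : R) (f : X -> \bar R) : 0 <= c -> (forall x, 0 <= f x)%E ->
  (\esum_(x in [set: X]) (c%:E * f x) = c%:E * \esum_(x in [set: X]) f x)%E.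
Proof.
rewrite le_eqVlt => /orP[/eqP<- f0|c0 f0].
  by rewrite mul0e esum1// => x _; rewrite mul0e.
have key (d : R) (g : X -> \bar R) : 0 < d -> (forall x, 0 <= g x)%E ->
    (\esum_(x in [set: X]) (d%:E * g x) <= d%:E * \esum_(x in [set: X]) g x)%E.
  move=> d0 g0; apply: ge_ereal_sup => /= _ [A [finA _] <-].
  rewrite fsbig_finite//= -ge0_sume_distrr//.
  apply: lee_wpmul2l; first by rewrite lee_fin ltW.
  apply: ereal_sup_ubound; exists A => //.
  by rewrite fsbig_finite.
apply/eqP; rewrite eq_le key//=.
have cV : (0 < c^-1) by rewrite invr_gt0.
have := key c^-1 (fun x => c%:E * f x)%E cV.
under eq_esum do rewrite muleA -EFinM mulVf ?gt_eqF// mul1e.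
move=> H; rewrite -lee_pdivlMl//; apply: H => x.
by rewrite mule_ge0// lee_fin ltW.
Qed.

Lemma rsummableZ (c : R) f : rsummable f -> rsummable (fun x => c * f x).
Proof.
rewrite !rsummableE => sf.
under eq_esum do rewrite normrM EFinM.
rewrite esumZl//; exact: lte_mul_pinfty.
Qed.

Lemma rsum_ge0 f : (forall x, 0 <= f x) ->
  rsum f = fine (\esum_(x in [set: X]) (f x)%:E).
Proof.
move=> f0; rewrite /rsum [X in _ - fine X]esum1 ?subr0.
  congr fine; apply: eq_esum => x _; rewrite funeposE/=.
  by apply/max_idPl; rewrite lee_fin.
move=> x _; rewrite funenegE/=.
by apply/max_idPr; rewrite /= lee_fin oppr_le0.
Qed.

Let fin_esum f : rsummable f -> (forall x, 0 <= f x) ->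
  (\esum_(x in [set: X]) (f x)%:E)%E \is a fin_num.
Proof.
move=> sf f0; rewrite ge0_fin_numE; last by apply: esum_ge0 => x _; rewrite lee_fin.
by apply: le_lt_trans sf; apply: le_esum => x _; rewrite /= lee_fin ler_norm.
Qed.

Lemma rsumB_ge0 f g : rsummable f -> rsummable g ->
  (forall x, 0 <= f x) -> (forall x, 0 <= g x) ->
  rsum (fun x => f x - g x) = rsum f - rsum g.
Proof.
move=> sf sg f0 g0; rewrite (rsum_ge0 f0) (rsum_ge0 g0).
rewrite -fineB ?fin_esum//.
have := @esumB R X [set: X] (EFin \o f) (EFin \o g) sf sg
  (fun i _ => f0 i) (fun i _ => g0 i).
move=> /= <-; rewrite fineB//.
- by rewrite ge0_fin_numE ?esum_ge0//;
    have := summable_funepos (summableB sf sg); rewrite /summable;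
    under eq_esum do rewrite gee0_abs//.
- by rewrite ge0_fin_numE ?esum_ge0//;
    have := summable_funeneg (summableB sf sg); rewrite /summable;
    under eq_esum do rewrite gee0_abs//.
Qed.

Let rpos f x := Num.max (f x) 0.
Let rneg f x := Num.max (- f x) 0.
Let rposneg f : f = (fun x => rpos f x - rneg f x).
Proof.
by apply/funext => x; rewrite /rpos /rneg /Num.max; do 2 case: ifPn => ?; lra.
Qed.
Let rpos_ge0 f x : 0 <= rpos f x. Proof. by rewrite le_max lexx orbT. Qed.
Let rneg_ge0 f x : 0 <= rneg f x. Proof. by rewrite le_max lexx orbT. Qed.
Let srpos f : rsummable f -> rsummable (rpos f).
Proof.
move=> sf; apply: (@rsummable_le _ (fun x => `|f x|)).
  by move=> x; rewrite ger0_norm// ge_max ler_norm normr_ge0.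
by move: sf; rewrite !rsummableE; under [in X in _ -> X]eq_esum do rewrite normr_id.
Qed.
Let srneg f : rsummable f -> rsummable (rneg f).
Proof.
move=> sf; apply: (@rsummable_le _ (fun x => `|f x|)).
  by move=> x; rewrite ger0_norm// ge_max -normrN ler_norm normr_ge0.
by move: sf; rewrite !rsummableE; under [in X in _ -> X]eq_esum do rewrite normr_id.
Qed.

Let rsumD_ge0 f g : rsummable f -> rsummable g ->
  (forall x, 0 <= f x) -> (forall x, 0 <= g x) ->
  rsum (fun x => f x + g x) = rsum f + rsum g.
Proof.
move=> sf sg f0 g0; rewrite !rsum_ge0//; last by move=> x; rewrite addr_ge0.
by rewrite -fineD ?fin_esum// -esumD// => x _; rewrite lee_fin.
Qed.

Lemma rsumD f g : rsummable f -> rsummable g ->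
  rsum (fun x => f x + g x) = rsum f + rsum g.
Proof.
move=> sf sg.
have -> : (fun x => f x + g x) =
    (fun x => (rpos f x + rpos g x) - (rneg f x + rneg g x)).
  apply/funext => x; rewrite {1}(rposneg f) {1}(rposneg g); lra.
rewrite rsumB_ge0; [|apply: rsummableD; exact: srpos
  |apply: rsummableD; exact: srneg|by move=> x; rewrite addr_ge0..].
rewrite !rsumD_ge0//; do ?[exact: srpos|exact: srneg].
rewrite [in RHS](rposneg f) [in RHS](rposneg g).
rewrite !rsumB_ge0//; do ?[exact: srpos|exact: srneg].
lra.
Qed.

Let rsumZ_ge0 c f : 0 <= c -> (forall x, 0 <= f x) ->
  rsum (fun x => c * f x) = c * rsum f.
Proof.
move=> c0 f0; rewrite !rsum_ge0//; last by move=> x; rewrite mulr_ge0.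
under eq_esum do rewrite EFinM.
rewrite esumZl//; set s := esum _ _.
have : (0 <= s)%E by apply: esum_ge0 => x _; rewrite lee_fin.
case: s => [s _|_|]//=.
rewrite mulr0 mulry /Num.sg; case: ifPn => _; first by rewrite mul0e.
by rewrite ltNge c0/= mul1e.
Qed.

Lemma rsumN f : rsum (fun x => - f x) = - rsum f.
Proof.
rewrite /rsum opprB; congr (fine _ - fine _); apply: eq_esum => x _.
  by rewrite funeposE funenegE.
by rewrite funeposE funenegE /= opprK.
Qed.

Lemma rsumZ c f : rsummable f -> rsum (fun x => c * f x) = c * rsum f.
Proof.
move=> sf; have ge0 d : 0 <= d -> rsum (fun x => d * f x) = d * rsum f.
  move=> d0; have -> : (fun x => d * f x) =
      (fun x => d * rpos f x - d * rneg f x).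
    by apply/funext => x; rewrite {1}(rposneg f); lra.
  rewrite rsumB_ge0; [|by apply: rsummableZ; exact: srpos
    |by apply: rsummableZ; exact: srneg|by move=> x; rewrite mulr_ge0..].
  rewrite !rsumZ_ge0// [in RHS](rposneg f) rsumB_ge0//; last 2 first.
    exact: srpos. exact: srneg.
  lra.
have [|/ltW c0] := leP 0 c; first exact: ge0.
apply: oppr_inj; rewrite -rsumN -mulNr -ge0 ?oppr_ge0//.
by congr rsum; apply/funext => x; rewrite mulNr.
Qed.

End sums.

Section csums.
Variables (R : realType) (X : choiceType).
Implicit Types (f g : X -> R[i]).

Definition csummable f :=
  rsummable (fun x => complex.Re (f x)) /\ rsummable (fun x => complex.Im (f x)).

Definition csum f : R[i] :=
  (rsum (fun x => complex.Re (f x)) +i* rsum (fun x => complex.Im (f x)))%C.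

Lemma csummableD f g :
  csummable f -> csummable g -> csummable (fun x => f x + g x).
Proof.
move=> [fr fi] [gr gi]; split.
  by have := rsummableD fr gr; congr rsummable; apply/funext => x; case: (f x); case: (g x).
by have := rsummableD fi gi; congr rsummable; apply/funext => x; case: (f x); case: (g x).
Qed.

Lemma csummableZ (c : R[i]) f : csummable f -> csummable (fun x => c * f x).
Proof.
case: c => a b [fr fi]; split.
  have := rsummableD (rsummableZ a fr) (rsummableZ (- b) fi).
  by congr rsummable; apply/funext => x; case: (f x) => u v /=; rewrite mulNr.
have := rsummableD (rsummableZ a fi) (rsummableZ b fr).
by congr rsummable; apply/funext => x; case: (f x).
Qed.

Lemma csumD f g : csummable f -> csummable g ->
  csum (fun x => f x + g x) = csum f + csum g.
Proof.
move=> [fr fi] [gr gi]; rewrite /csum; apply/eqP; rewrite eq_complex/=.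
rewrite -rsumD// -rsumD//; apply/andP; split; apply/eqP; congr rsum;
  by apply/funext => x; case: (f x); case: (g x).
Qed.

Lemma csumZ (c : R[i]) f : csummable f -> csum (fun x => c * f x) = c * csum f.
Proof.
case: c => a b [fr fi]; rewrite /csum; apply/eqP; rewrite eq_complex/=.
apply/andP; split; apply/eqP.
  rewrite -mulNr -!rsumZ// -rsumD; [|exact: rsummableZ..].
  by congr rsum; apply/funext => x; case: (f x) => u v /=; rewrite mulNr.
rewrite -!rsumZ// -rsumD; [|exact: rsummableZ..].
by congr rsum; apply/funext => x; case: (f x) => u v.
Qed.

Lemma csum_conj f : csum (fun x => (f x)^*) = (csum f)^*.
Proof.
rewrite /csum; apply/eqP; rewrite eq_complex/=; apply/andP; split; apply/eqP.
  by congr rsum; apply/funext => x; case: (f x).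
by rewrite -rsumN; congr rsum; apply/funext => x; case: (f x).
Qed.

End csums.

Definition sqmod (R : realType) (z : R[i]) : R :=
  complex.Re z ^+ 2 + complex.Im z ^+ 2.

Section hilbert.
Variable R : realType.

Definition dnorm (U : lmodType R[i]) (dot : {dot U for Num.conj}) (u : U) : R :=
  Num.sqrt (complex.Re (dot u u)).

Record hilbert := Hilbert {
  hilbert_lmod :> lmodType R[i];
  hdot : {dot hilbert_lmod for Num.conj};
  hilbert_complete : forall u : nat -> hilbert_lmod,
    (forall e : R, 0 < e ->
      exists N, forall m n, (N <= m)%N -> (N <= n)%N ->
        dnorm hdot (u m - u n) < e) ->
    exists l, forall e : R, 0 < e ->
      exists N, forall n, (N <= n)%N -> dnorm hdot (u n - l) < e }.

Definition hnorm (H : hilbert) (u : H) : R := dnorm (hdot H) u.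

End hilbert.

Section ell2.
Variables (R : realType) (X : choiceType).

Definition ell2_pred : {pred X -> R[i]} :=
  fun f => `[< rsummable (fun x => sqmod (f x)) >].

Lemma sqmod_ge0 (z : R[i]) : 0 <= sqmod z.
Proof. by rewrite addr_ge0// sqr_ge0. Qed.

Lemma ell2_submod : submod_closed ell2_pred.
Proof.
split.
  apply/asboolP; apply: (@rsummable_le _ _ _ (fun=> 0)).
    by move=> x; rewrite /sqmod/= expr0n/= addr0 normr0.
  rewrite rsummableE esum1 ?ltry// => x _.
  by rewrite normr0.
move=> c f g /asboolP sf /asboolP sg; apply/asboolP.
have := rsummableD (rsummableZ (2 * sqmod c) sf) (rsummableZ 2 sg).
apply: rsummable_le => x.
rewrite ger0_norm ?sqmod_ge0//= /sqmod.
have -> : (c *: f + g) x = c * f x + g x by [].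
case: (c) (f x) (g x) => a b [p q] [r s] /=.
have h1 := sqr_ge0 (a * p - b * q - r).
have h2 := sqr_ge0 (a * q + b * p - s).
rewrite -subr_ge0; apply: le_trans (addr_ge0 h1 h2) _.
rewrite le_eqVlt; apply/orP; left; apply/eqP; ring.
Qed.

HB.instance Definition _ :=
  GRing.isSubmodClosed.Build R[i] (X -> R[i]) ell2_pred ell2_submod.

Record ell2 := Ell2 { ell2_fun :> X -> R[i]; _ : ell2_fun \in ell2_pred }.

HB.instance Definition _ := [isSub for ell2_fun].
HB.instance Definition _ := [Choice of ell2 by <:].
HB.instance Definition _ := [SubChoice_isSubLmodule of ell2 by <:].

Definition ell2_dot (f g : ell2) : R[i] := csum (fun x => f x * (g x)^*).

End ell2.

Section ell2_hilbert.
Variables (R : realType) (X : choiceType).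
Local Notation ell2 := (ell2 R X).
Implicit Types f g h : ell2.

Lemma ell2P f : rsummable (fun x => sqmod (f x)).
Proof. by case: f => f /= /asboolP. Qed.

Lemma ell2_ext f g : (forall x, f x = g x) -> f = g.
Proof. by move=> fg; apply: val_inj; apply/funext => x; exact: fg. Qed.

Lemma ell2_dot_summable f g : csummable (fun x => f x * (g x)^*).
Proof.
split; have := rsummableD (ell2P f) (ell2P g); apply: rsummable_le => x;
  case: (f x) (g x) => p q [r s] /=; rewrite /sqmod/= ler_norml; apply/andP; split;
  have h1 := sqr_ge0 (p - r); have h2 := sqr_ge0 (q - s);
  have h3 := sqr_ge0 (p + r); have h4 := sqr_ge0 (q + s);
  have h5 := sqr_ge0 (p - s); have h6 := sqr_ge0 (q - r);
  have h7 := sqr_ge0 (p + s); have h8 := sqr_ge0 (q + r); nra.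
Qed.

Lemma ell2_dotC f g : ell2_dot f g = (ell2_dot g f)^*.
Proof.
rewrite -csum_conj; congr csum; apply/funext => x.
by rewrite rmorphM /= conjCK mulrC.
Qed.

Lemma ell2_dotP h : linear_for *%R (fun f => ell2_dot f h).
Proof.
move=> c f g; rewrite /ell2_dot.
have -> : (fun x => (c *: f + g) x * (h x)^*) =
  (fun x => c * (f x * (h x)^*) + g x * (h x)^*).
  apply/funext => x.
  have -> : (c *: f + g) x = c * f x + g x by [].
  by rewrite mulrDl mulrA.
rewrite csumD ?csumZ//.
- exact: ell2_dot_summable.
- exact: csummableZ (ell2_dot_summable f h).
- exact: ell2_dot_summable.
Qed.

Lemma ell2_dot_linearr h : linear_for (Num.conj \; *%R) (fun f => ell2_dot h f).
Proof.
move=> c f g.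
by rewrite ell2_dotC ell2_dotP rmorphD rmorphM (ell2_dotC h f) (ell2_dotC h g).
Qed.

Lemma ell2_dot_bilinear :
  bilinear_for (GRing.Scale.Law.clone _ _ *%R _)
    (GRing.Scale.Law.clone _ _ (Num.conj \; *%R) _) (@ell2_dot R X).
Proof. by split; [exact: ell2_dotP|exact: ell2_dot_linearr]. Qed.

HB.instance Definition _ :=
  bilinear_isBilinear.Build R[i] ell2 ell2 _ _ _ (@ell2_dot R X) ell2_dot_bilinear.

Fact ell2_dot_herm f g : ell2_dot f g = (-1) ^+ false * (ell2_dot g f)^*.
Proof. by rewrite mul1r ell2_dotC. Qed.

HB.instance Definition _ :=
  isHermitianSesquilinear.Build R[i] ell2 false Num.conj (@ell2_dot R X) ell2_dot_herm.

Lemma ell2_dotE f :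
  ell2_dot f f = (fine (\esum_(x in [set: X]) (sqmod (f x))%:E))%:C%C.
Proof.
rewrite /ell2_dot /csum; apply/eqP; rewrite eq_complex/=; apply/andP; split; apply/eqP.
  rewrite -rsum_ge0; last by move=> x; exact: sqmod_ge0.
  congr rsum; apply/funext => x; rewrite /sqmod; case: (f x) => a b /=.
  by rewrite mulrN opprK !expr2.
rewrite rsum_ge0; last by move=> x; case: (f x) => a b /=; rewrite mulrN mulrC addNr.
rewrite esum1// => x _; case: (f x) => a b /=; by rewrite mulrN mulrC addNr.
Qed.

Lemma ell2_esum_fin f : (\esum_(x in [set: X]) (sqmod (f x))%:E)%E \is a fin_num.
Proof.
rewrite ge0_fin_numE; last by apply: esum_ge0 => x _; rewrite lee_fin sqmod_ge0.
apply: le_lt_trans (ell2P f); apply: le_esum => x _.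
by rewrite /= lee_fin ler_norm.
Qed.

Lemma sqmod_le_dot f x : sqmod (f x) <= complex.Re (ell2_dot f f).
Proof.
rewrite ell2_dotE /= -lee_fin fineK ?ell2_esum_fin//.
apply: esum_ge; exists [set x]; first by split.
by rewrite fsbig_set1.
Qed.

Fact ell2_dot_gt0 f : f != 0 -> 0 < ell2_dot f f.
Proof.
move=> f0; rewrite ell2_dotE ltcR.
have [x fx] : exists x, f x != 0.
  apply/not_existsP => H; move/negP: f0; apply; apply/eqP.
  by apply: ell2_ext => x; apply: contrapT => /eqP; exact: H.
have := sqmod_le_dot f x; rewrite ell2_dotE /=; apply: lt_le_trans.
rewrite /sqmod.
rewrite lt_def addr_ge0 ?sqr_ge0// andbT paddr_eq0 ?sqr_ge0// !sqrf_eq0.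
by move: fx; rewrite eq_complex.
Qed.

HB.instance Definition _ :=
  isDotProduct.Build R[i] ell2 (@ell2_dot R X) ell2_dot_gt0.

End ell2_hilbert.

Section completeness.
Variable R : realType.

Lemma real_cauchy_cvg (u : nat -> R) :
  (forall e, 0 < e -> exists N, forall m n, (N <= m)%N -> (N <= n)%N ->
     `|u m - u n| < e) -> cvg (u @ \oo).
Proof.
move=> cu; apply/cauchy_cvgP/cauchy_exP => e e0.
have [N HN] := cu e e0; exists (u N); exists N => // n /= Nn.
by rewrite /ball/=; exact: HN.
Qed.

Lemma normRe_le (z : R[i]) : `|complex.Re z| <= Num.sqrt (sqmod z).
Proof. by rewrite -sqrtr_sqr ler_wsqrtr// lerDl sqr_ge0. Qed.

Lemma normIm_le (z : R[i]) : `|complex.Im z| <= Num.sqrt (sqmod z).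
Proof. by rewrite -sqrtr_sqr ler_wsqrtr// lerDr sqr_ge0. Qed.

Lemma complex_cauchy_cvg (u : nat -> R[i]) :
  (forall e, 0 < e -> exists N, forall m n, (N <= m)%N -> (N <= n)%N ->
     Num.sqrt (sqmod (u m - u n)) < e) ->
  exists l : R[i], forall z : R[i], sqmod (z - u n) @[n --> \oo] --> sqmod (z - l).
Proof.
move=> cu.
have cr : cvg ((fun n => complex.Re (u n)) @ \oo).
  apply: real_cauchy_cvg => e /cu[N HN]; exists N => m n Nm Nn.
  apply: le_lt_trans (HN m n Nm Nn); apply: le_trans (normRe_le _).
  by case: (u m) (u n) => [a b] [c d].
have ci : cvg ((fun n => complex.Im (u n)) @ \oo).
  apply: real_cauchy_cvg => e /cu[N HN]; exists N => m n Nm Nn.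
  apply: le_lt_trans (HN m n Nm Nn); apply: le_trans (normIm_le _).
  by case: (u m) (u n) => [a b] [c d].
pose a : R := lim ((fun n => complex.Re (u n)) @ \oo).
pose b : R := lim ((fun n => complex.Im (u n)) @ \oo).
exists (a +i* b)%C => -[p q].
have -> : (fun n => sqmod ((p +i* q)%C - u n)) =
    (fun n => (p - complex.Re (u n)) * (p - complex.Re (u n)) +
              (q - complex.Im (u n)) * (q - complex.Im (u n))).
  by apply/funext => n; rewrite /sqmod; case: (u n) => r s /=; rewrite !expr2.
rewrite /sqmod /= !expr2.
by apply: cvgD; apply: cvgM; apply: cvgB => //; exact: cvg_cst.
Qed.

Lemma dnorm_ell2E (X : choiceType) (f : ell2 R X) :
  dnorm (@ell2_dot R X) f =
  Num.sqrt (fine (\esum_(x in [set: X]) (sqmod (f x))%:E)).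
Proof. by have /(congr1 (@complex.Re R)) /(congr1 Num.sqrt) := ell2_dotE f. Qed.

Lemma ell2_complete (X : choiceType) (u : nat -> ell2 R X) :
  (forall e : R, 0 < e ->
    exists N, forall m n, (N <= m)%N -> (N <= n)%N ->
      dnorm (@ell2_dot R X) (u m - u n) < e) ->
  exists l, forall e : R, 0 < e ->
    exists N, forall n, (N <= n)%N -> dnorm (@ell2_dot R X) (u n - l) < e.
Proof.
move=> cu.
have /choice[l Hl] x : exists l : R[i], forall z : R[i],
    sqmod (z - u n x) @[n --> \oo] --> sqmod (z - l).
  apply: complex_cauchy_cvg => e /cu[N HN]; exists N => m n Nm Nn.
  apply: le_lt_trans (HN m n Nm Nn); rewrite ler_wsqrtr//.
  exact: (sqmod_le_dot (u m - u n) x).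
have bound (e : R) : 0 < e -> exists N, forall n, (N <= n)%N ->
    (\esum_(x in [set: X]) (sqmod (u n x - l x))%:E <= (e ^+ 2)%:E)%E.
  move=> e0; have [N HN] := cu e e0; exists N => n Nn.
  apply: ge_ereal_sup => /= _ [A [finA _] <-].
  rewrite fsbig_finite//= sumEFin lee_fin.
  have cs : (\sum_(x <- fset_set A) sqmod (u n x - u m x)) @[m --> \oo] -->
      \sum_(x <- fset_set A) sqmod (u n x - l x).
    elim: (enum_fset _) => [|x s IH].
      rewrite big_nil; under eq_fun do rewrite big_nil; exact: cvg_cst.
    rewrite big_cons; under eq_fun do rewrite big_cons.
    by apply: cvgD => //; exact: Hl.
  apply: (cvgr_to_le cs); exists N => // m /= Nm.
  have := HN n m Nn Nm; rewrite dnorm_ell2E => /ltW.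
  set s := fine _ => se.
  have s0 : 0 <= s.
    by apply: fine_ge0; apply: esum_ge0 => x _; rewrite lee_fin sqmod_ge0.
  apply: (@le_trans _ _ s); last first.
    by rewrite -(sqr_sqrtr s0) lerXn2r// ?nnegrE ?sqrtr_ge0// ltW.
  rewrite -lee_fin /s fineK; last exact: (ell2_esum_fin (u n - u m)).
  apply: esum_ge; exists A; first by split.
  by rewrite fsbig_finite//= sumEFin.
have dl n : (\esum_(x in [set: X]) (sqmod (u n x - l x))%:E < +oo)%E ->
    (fun x => u n x - l x) \in @ell2_pred R X.
  move=> H; apply/asboolP; rewrite rsummableE.
  by under eq_esum do rewrite ger0_norm ?sqmod_ge0//.
have [N0 HN0] := bound 1 ltr01.
have ml : l \in @ell2_pred R X.
  have -> : l = (u N0 : X -> R[i]) - (fun x => u N0 x - l x).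
    apply/funext => x.
    rewrite -[RHS]/(u N0 x - (u N0 x - l x)).
    by rewrite opprB addrC subrK.
  apply: rpredB; first exact: valP.
  by apply: dl; apply: le_lt_trans (HN0 _ (leqnn _)) _; rewrite ltry.
exists (Ell2 ml) => e e0.
have e20 : 0 < e / 2 by lra.
have [N HN] := bound (e / 2) e20.
exists N => n Nn; rewrite dnorm_ell2E.
apply: (@le_lt_trans _ _ (e / 2)); last by lra.
rewrite -[leRHS]ger0_norm; last by lra.
rewrite -sqrtr_sqr ler_wsqrtr// -lee_fin fineK; last exact: (ell2_esum_fin (u n - Ell2 ml)).
exact: HN.
Qed.

Definition ell2_hilbert (X : choiceType) : hilbert R :=
  Hilbert (@ell2_complete X).

Definition C_dot (z w : R[i]^o) : R[i] := z * w^*.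

Fact C_dot_bilinear :
  bilinear_for (GRing.Scale.Law.clone _ _ *%R _)
    (GRing.Scale.Law.clone _ _ (Num.conj \; *%R) _) C_dot.
Proof.
split=> w a u v; rewrite /C_dot /=; first by rewrite mulrDl -mulrA.
by rewrite rmorphD rmorphM /= mulrDr mulrCA.
Qed.

HB.instance Definition _ :=
  bilinear_isBilinear.Build R[i] R[i]^o R[i]^o _ _ _ C_dot C_dot_bilinear.

Fact C_dot_herm z w : C_dot z w = (-1) ^+ false * (C_dot w z)^*.
Proof. by rewrite mul1r /C_dot rmorphM /= conjCK mulrC. Qed.

HB.instance Definition _ :=
  isHermitianSesquilinear.Build R[i] R[i]^o false Num.conj C_dot C_dot_herm.

Fact C_dot_gt0 z : z != 0 -> 0 < C_dot z z.
Proof. by move=> z0; rewrite /C_dot -normCK exprn_gt0// normr_gt0. Qed.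

HB.instance Definition _ := isDotProduct.Build R[i] R[i]^o C_dot C_dot_gt0.

Lemma dnorm_CE (z : R[i]^o) : dnorm C_dot z = Num.sqrt (sqmod z).
Proof.
rewrite /dnorm /sqmod; congr Num.sqrt; case: z => a b.
by rewrite -[LHS]/(a * a - b * - b) mulrN opprK !expr2.
Qed.

Lemma C_complete (u : nat -> R[i]^o) :
  (forall e : R, 0 < e ->
    exists N, forall m n, (N <= m)%N -> (N <= n)%N ->
      dnorm C_dot (u m - u n) < e) ->
  exists l, forall e : R, 0 < e ->
    exists N, forall n, (N <= n)%N -> dnorm C_dot (u n - l) < e.
Proof.
move=> cu; have [|l Hl] := @complex_cauchy_cvg u.
  move=> e /cu[N HN]; exists N => m n Nm Nn.
  by rewrite -dnorm_CE; exact: HN.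
exists l => e e0; have e20 : 0 < e / 2 by lra.
have [N HN] := cu _ e20; exists N => n Nn.
apply: (@le_lt_trans _ _ (e / 2)); last by lra.
rewrite dnorm_CE -[leRHS]ger0_norm; last exact: ltW.
rewrite -sqrtr_sqr ler_wsqrtr//.
apply: (cvgr_to_le (Hl (u n))); exists N => // m /= Nm.
have := HN n m Nn Nm; rewrite dnorm_CE => /ltW h.
rewrite -(@sqr_sqrtr _ (sqmod (u n - u m))) ?sqmod_ge0//.
by rewrite lerXn2r// ?nnegrE ?sqrtr_ge0// ltW.
Qed.

Definition C_hilbert : hilbert R := Hilbert C_complete.

End completeness.

Section unitary_representations.
Variables (R : realType) (Gam : groupType).

(* Each rep_op g is surjective by the group law, hence a linear isometry is
   enough for unitarity. *)
Record unitary_rep := UnitaryRep {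
  rep_space : hilbert R;
  rep_op :> Gam -> {linear rep_space -> rep_space};
  rep_op1 : forall u, rep_op 1%g u = u;
  rep_opM : forall g h u, rep_op (g * h)%g u = rep_op g (rep_op h u);
  rep_op_dot : forall g u v,
    hdot rep_space (rep_op g u) (rep_op g v) = hdot rep_space u v }.

Definition group_alg := {fsfun Gam -> R[i] with 0}.

Definition rep_alg (pi : unitary_rep) (a : group_alg) (u : rep_space pi) :
    rep_space pi :=
  \sum_(g <- finsupp a) a g *: pi g u.

(* C*(Gam) is the completion of C[Gam] for the norm sup_pi ||pi(a)||, pi ranging
   over all unitary representations.  That norm is the one induced by the map
   a |-> (pi(a))_pi into the l^oo-product of the algebras B(H_pi), which is
   complete, so the completion is the norm closure of the image of C[Gam]: the
   families (x(pi))_pi that are limits of elements of C[Gam], uniformly in pi.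
   The extension of pi to C*(Gam) is the evaluation x |-> x(pi).  Linearity and
   boundedness of each x(pi) follow from cstar_approx. *)
Record max_cstar := MaxCstar {
  cstar_ev :> forall pi : unitary_rep, rep_space pi -> rep_space pi;
  cstar_approx : forall e : R, 0 < e -> exists a : group_alg,
    forall (pi : unitary_rep) (u : rep_space pi),
      hnorm (cstar_ev u - rep_alg a u) <= e * hnorm u }.

(* Valued in \bar R so that no boundedness side condition is needed; it is
   finite for the operators x(pi), which are uniform limits of the bounded
   operators pi(a). *)
Definition opnorm (H : hilbert R) (T : H -> H) : \bar R :=
  ereal_sup [set (hnorm (T u))%:E | u in [set u : H | hnorm u <= 1]].

Definition weakly_contained (rho pi : unitary_rep) : Prop :=
  forall x : max_cstar, (opnorm (@cstar_ev x rho) <= opnorm (@cstar_ev x pi))%E.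

Definition weakly_equivalent (rho pi : unitary_rep) : Prop :=
  weakly_contained rho pi /\ weakly_contained pi rho.

Fact group_alg_approx (a : group_alg) (e : R) : 0 < e -> exists b : group_alg,
  forall (pi : unitary_rep) (u : rep_space pi),
    hnorm (rep_alg a u - rep_alg b u) <= e * hnorm u.
Proof.
move=> e0; exists a => pi u; rewrite subrr.
rewrite {1}/hnorm /dnorm linear0l sqrtr0 mulr_ge0// ?sqrtr_ge0//.
exact: ltW.
Qed.

Definition cstar_of (a : group_alg) : max_cstar :=
  @MaxCstar (fun pi => @rep_alg pi a) (group_alg_approx a).

Definition trivial_rep : unitary_rep :=
  @UnitaryRep (C_hilbert R) (fun=> idfun)
    (fun=> erefl) (fun _ _ _ => erefl) (fun _ _ _ => erefl).

End unitary_representations.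

Record gaction (Gam : groupType) (X : Type) := GAction {
  gact :> Gam -> X -> X;
  gact1 : forall x, gact 1%g x = x;
  gactM : forall g h x, gact (g * h)%g x = gact g (gact h x) }.

Section permutation_rep.
Variables (R : realType) (Gam : groupType) (X : choiceType).
Variable a : gaction Gam X.

Lemma gactK g : cancel (a g) (a g^-1%g).
Proof. by move=> x; rewrite -gactM mulVg gact1. Qed.

Lemma gactVK g : cancel (a g^-1%g) (a g).
Proof. by move=> x; rewrite -gactM mulgV gact1. Qed.

Lemma esum_gact g (f : X -> \bar R) :
  (\esum_(x in [set: X]) f (a g x) = \esum_(x in [set: X]) f x)%E.
Proof.
symmetry; apply: reindex_esum; split => //.
- by move=> x y _ _; exact: (can_inj (gactK g)).
- by move=> x _; exists (a g^-1%g x) => //; exact: gactVK.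
Qed.

Lemma rsum_gact g (f : X -> R) : rsum (fun x => f (a g x)) = rsum f.
Proof.
rewrite /rsum; congr (fine _ - fine _); rewrite -[RHS](esum_gact g);
  by apply: eq_esum => x _; rewrite ?funeposE ?funenegE.
Qed.

Fact translate_subproof g (f : ell2 R X) :
  (fun x => f (a g^-1%g x)) \in @ell2_pred R X.
Proof.
apply/asboolP; rewrite rsummableE.
by rewrite (esum_gact g^-1%g (fun x => `|sqmod (f x)|%:E)); exact: ell2P.
Qed.

Definition translate g (f : ell2 R X) : ell2 R X := Ell2 (translate_subproof g f).

Fact translate_linear g : linear (translate g).
Proof. by move=> c f h; apply: ell2_ext. Qed.

HB.instance Definition _ g :=
  GRing.isLinear.Build R[i] (ell2 R X) (ell2 R X) _ (translate g) (translate_linear g).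

Fact translate1 f : translate 1%g f = f.
Proof. by apply: ell2_ext => x /=; rewrite invg1 gact1. Qed.

Fact translateM g h f : translate (g * h)%g f = translate g (translate h f).
Proof. by apply: ell2_ext => x /=; rewrite invgM gactM. Qed.

Fact translate_dot g f h :
  ell2_dot (translate g f) (translate g h) = ell2_dot f h.
Proof.
rewrite /ell2_dot /csum; congr (_ +i* _)%C.
  exact: (rsum_gact g^-1%g (fun x => complex.Re (f x * (h x)^*))).
exact: (rsum_gact g^-1%g (fun x => complex.Im (f x * (h x)^*))).
Qed.

Definition permutation_rep : unitary_rep R Gam :=
  @UnitaryRep R Gam (ell2_hilbert R X) translate translate1 translateM translate_dot.

Definition has_spectral_gap : Prop :=
  ~ weakly_contained (trivial_rep R Gam) permutation_rep.

End permutation_rep.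

Section subgroups.
Variables (R : realType) (G : groupType).
Implicit Types (H L : groupClosed G) (A B : set G).

Record subgroup H := Subgroup { subgroup_val :> G; _ : subgroup_val \in H }.
HB.instance Definition _ H := [isSub for @subgroup_val H].
HB.instance Definition _ H := [Choice of subgroup H by <:].
Fact subgroup_closed H : group_closed (fun x => x \in H).
Proof. by split; [exact: gpred1|move=> x y; exact: gpredF]. Qed.
HB.instance Definition _ H :=
  SubChoice_isSubGroup.Build G _ (subgroup H) (subgroup_closed H).

Definition left_translate (g : G) A : set G := [set (g * x)%g | x in A].

Lemma left_translate1 A : left_translate 1%g A = A.
Proof.
apply/seteqP; split=> [_ [x Ax <-]|x Ax]; first by rewrite mul1g.
by exists x => //; rewrite mul1g.
Qed.

Lemma left_translateM g h A :
  left_translate (g * h)%g A = left_translate g (left_translate h A).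
Proof.
apply/seteqP; split=> [_ [x Ax <-]|_ [_ [x Ax <-] <-]].
  by exists (h * x)%g; [exists x|rewrite mulgA].
by exists x => //; rewrite mulgA.
Qed.

Definition is_left_coset H : pred (set G) :=
  fun A => `[< exists g, A = left_translate g [set` H] >].

(* The set G/H, its points being the left cosets themselves. *)
Definition cosets H : choiceType := {A : set G | is_left_coset H A}.

Fact coset_translate_subproof H g (A : cosets H) :
  is_left_coset H (left_translate g (val A)).
Proof.
case: A => A /= /asboolP[h ->]; apply/asboolP; exists (g * h)%g.
by rewrite left_translateM.
Qed.

Definition coset_translate H g (A : cosets H) : cosets H :=
  Sub (left_translate g (val A)) (coset_translate_subproof g A).

Fact coset_translate1 H (A : cosets H) : coset_translate 1%g A = A.
Proof. by apply: val_inj; exact: left_translate1. Qed.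

Fact coset_translateM H g h (A : cosets H) :
  coset_translate (g * h)%g A = coset_translate g (coset_translate h A).
Proof. by apply: val_inj; exact: left_translateM. Qed.

Definition coset_action H : gaction G (cosets H) :=
  GAction (@coset_translate1 H) (@coset_translateM H).

Definition quasi_regular H : unitary_rep R G := permutation_rep R (coset_action H).

(* The set G/H \ {H}, on which H acts by left translation. *)
Definition nontrivial_cosets H : choiceType := {A : cosets H | val A != [set` H]}.

Fact nontrivial_translate_subproof H (h : subgroup H) (A : nontrivial_cosets H) :
  val (coset_translate (h : G) (val A)) != [set` H].
Proof.
case: A => A /=; apply: contra => /eqP hA; apply/eqP.
have -> : val A = left_translate (h : G)^-1%g (left_translate h (val A)).
  by rewrite -left_translateM mulVg left_translate1.
have hH : (h : G) \in H by exact: valP.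
rewrite hA; apply/seteqP; split=> [_ [x /= Hx <-]|x /= Hx].
  by rewrite gpredMl// gpredV.
by exists ((h : G) * x)%g; [rewrite /= gpredMl|rewrite mulKg].
Qed.

Definition nontrivial_translate H (h : subgroup H) (A : nontrivial_cosets H) :
    nontrivial_cosets H :=
  Sub (coset_translate (h : G) (val A)) (nontrivial_translate_subproof h A).

Fact nontrivial_translate1 H (A : nontrivial_cosets H) :
  nontrivial_translate 1%g A = A.
Proof. by apply: val_inj; exact: coset_translate1. Qed.

Fact nontrivial_translateM H (g h : subgroup H) (A : nontrivial_cosets H) :
  nontrivial_translate (g * h)%g A =
  nontrivial_translate g (nontrivial_translate h A).
Proof. by apply: val_inj; exact: coset_translateM. Qed.

Definition nontrivial_coset_action H : gaction (subgroup H) (nontrivial_cosets H) :=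
  GAction (@nontrivial_translate1 H) (@nontrivial_translateM H).

Definition Sub_sg H : Prop := has_spectral_gap R (nontrivial_coset_action H).

Definition conj_set (g : G) A : set G := [set (g * x * g^-1)%g | x in A].

(* For a subgroup A of B: finitely many left cosets b A with b in B. *)
Definition finite_index A B : Prop :=
  finite_set [set left_translate b A | b in B].

Definition commensurator L : set G :=
  [set g | let K := conj_set g [set` L] `&` [set` L] in
           finite_index K [set` L] /\ finite_index K (conj_set g [set` L])].

Definition self_commensurating L : Prop := commensurator L = [set` L].

Definition conjugate L H : Prop := exists g, [set` L] = conj_set g [set` H].

End subgroups.

(* Main.v *)
From HB Require Import structures.
Require Import Defs.
From mathcomp Require Import all_boot all_order all_algebra.
From mathcomp Require Import all_classical all_reals all_analysis.
From mathcomp Require Import finmap complex ring lra.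

Set Implicit Arguments.
Unset Strict Implicit.
Unset Printing Implicit Defensive.

Import Order.TTheory GRing.Theory Num.Theory Normc.
Import numFieldNormedType.Exports.

Local Open Scope classical_set_scope.
Local Open Scope ring_scope.

(** Write lambda_H and lambda_L for the two quasi-regular representations.

    Conjugate subgroups: if L = g H g^-1, then right translation by g is a
    G-equivariant bijection of G/L onto G/H, so lambda_H and lambda_L are
    unitarily equivalent, and equivalence passes to the completion because its
    elements are uniform limits of elements of the group algebra
    ([weakly_contained_isometry], [conj_set_weakly_contained]).

    Weakly equivalent representations: by the spectral gap there is an element a
    of the group algebra of H, with coefficients summing to 1, acting on the
    orthogonal complement of the base vector e (the point mass at the coset H)
    with norm at most some r < 1 ([spectral_gap_comb], [Sub_sg_comb]).  Since a
    fixes e, the powers a^n converge in norm, under lambda_H, to the rank-one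
    projection P onto e, which satisfies h P = P for h in H, and P g P = 0 for g
    outside H.  Each of these is an estimate, with error O(r^n), on the norm of
    an element of the group algebra of G; weak equivalence transports them to
    lambda_L, where a^n therefore converges to a nonzero projection.  Any nonzero
    vector v in its range is H-invariant and orthogonal to g v for g outside H
    ([transfer_vector]).

    Choose a coset xL at which v does not vanish.  As v is constant on the
    H-orbit of xL, that orbit is finite; as the translates of v by elements of
    x L x^-1 lying in distinct cosets of H are orthogonal and have the same
    nonzero value at xL, there are only finitely many such cosets
    ([fixed_finite_index], [orthogonal_finite_index]).  So H and x L x^-1 are
    commensurable, and H is contained in x L x^-1 because L is
    self-commensurating ([commensurable_commensurator]).  Equality holds: the
    nontrivial cosets of H inside x L x^-1 form a finite H-invariant set, and a
    nonempty one would produce an H-invariant vector in l^2(G/H \ {H}),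
    contradicting the spectral gap ([Sub_sg_finite_index]). *)

(** * Norms of complex numbers and geometric bounds *)

Section reals.
Variable R : realType.

Lemma normc_ge0 (c : R[i]) : 0 <= normc c.
Proof. by case: c => a b; exact: sqrtr_ge0. Qed.

Lemma normc_eq0 (c : R[i]) : normc c <= 0 -> c = 0.
Proof. by move=> c0; apply: eq0_normc; apply/eqP; rewrite eq_le c0 normc_ge0. Qed.

Lemma normc_real (x : R) : 0 <= x -> normc x%:C%C = x.
Proof. by move=> x0; rewrite /= expr0n addr0 sqrtr_sqr ger0_norm. Qed.

Lemma sqmod_gt0 (c : R[i]) : c != 0 -> 0 < sqmod c.
Proof.
move=> c0; rewrite lt_def sqmod_ge0 andbT /sqmod paddr_eq0 ?sqr_ge0//.
by rewrite !sqrf_eq0; move: c0; rewrite eq_complex.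
Qed.

Lemma geometric_le0 (r C x : R) : 0 <= r -> r < 1 ->
  (forall n, x <= C * r ^+ n) -> x <= 0.
Proof.
move=> r0 r1 xr.
have cv : C * r ^+ n @[n --> \oo] --> C * 0.
  by apply: cvgM; [exact: cvg_cst|apply: cvg_expr; rewrite ger0_norm].
by rewrite -(mulr0 C); apply: (cvgr_to_ge cv); exact: nearW.
Qed.

Lemma bounded_card_finite (T : choiceType) (S : set T) (c M : R) : 0 < c ->
  (forall B : {fset T}, [set` B] `<=` S -> (#|` B|)%:R * c <= M) ->
  finite_set S.
Proof.
move=> c0 bd; apply: contrapT => infS.
have [B BS Bn] := infinite_set_fset (Num.bound `|M / c|) infS.
have := bd B BS; rewrite -ler_pdivlMr// leNgt => /negP[].
apply: le_lt_trans (ler_norm _) _.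
by apply: lt_le_trans (archi_boundP (normr_ge0 _)) _; rewrite ler_nat.
Qed.

End reals.

(** * Hilbert space inequalities *)

Section hilbert_norm.
Variables (R : realType) (V : hilbert R).
Implicit Types (u v w : V) (c : R[i]).

Lemma hnorm_ge0 u : 0 <= hnorm u.
Proof. exact: sqrtr_ge0. Qed.

Lemma hdot_sqr u : hdot V u u = (hnorm u ^+ 2)%:C%C.
Proof.
have := dnorm_ge0 (hdot V) u; rewrite /hnorm /dnorm.
by case: (hdot V u u) => a b; rewrite lecE /= => /andP[/eqP -> a0]; rewrite sqr_sqrtr.
Qed.

Lemma hnorm0 : hnorm (0 : V) = 0.
Proof. by rewrite /hnorm /dnorm linear0l sqrtr0. Qed.

Lemma hnorm_eq0 u : hnorm u = 0 -> u = 0.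
Proof.
move=> u0; apply/eqP; rewrite -(dnorm_eq0 (hdot V)) hdot_sqr u0.
by rewrite expr0n.
Qed.

Lemma hnormZ c u : hnorm (c *: u) = normc c * hnorm u.
Proof.
have : (hnorm (c *: u) ^+ 2)%:C%C = ((normc c * hnorm u) ^+ 2)%:C%C.
  rewrite -hdot_sqr dnormZ hdot_sqr exprMn [RHS]rmorphM; congr (_ * _).
  by rewrite rmorphXn /= normc_def; case: c.
move=> /complexI /eqP; rewrite eqrXn2 ?mulr_ge0 ?hnorm_ge0//; first by move/eqP.
by case: c => ? ?; exact: sqrtr_ge0.
Qed.

Lemma hnormN u : hnorm (- u) = hnorm u.
Proof. by rewrite -scaleN1r hnormZ normcN normc1 mul1r. Qed.

Lemma hnorm_sqrD u v :
  hnorm (u + v) ^+ 2 =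
  hnorm u ^+ 2 + hnorm v ^+ 2 + 2 * complex.Re (hdot V u v).
Proof.
apply: complexI; rewrite -hdot_sqr dnormD !hdot_sqr; case: (hdot V u v) => a b.
by apply/eqP; rewrite eq_complex /= mulr2n mulrDl mul1r subrr !addr0 !eqxx.
Qed.

(** Cauchy-Schwarz for the real part; the modulus follows by multiplying one of
    the vectors by the conjugate of the inner product. *)
Lemma Re_hdot_le u v : complex.Re (hdot V u v) <= hnorm u * hnorm v.
Proof.
have [/hnorm_eq0 ->|u0] := eqVneq (hnorm u) 0.
  by rewrite linear0l hnorm0 mul0r.
have [/hnorm_eq0 ->|v0] := eqVneq (hnorm v) 0.
  by rewrite linear0r hnorm0 mulr0.
have u1 : 0 < hnorm u by rewrite lt_def u0 hnorm_ge0.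
have v1 : 0 < hnorm v by rewrite lt_def v0 hnorm_ge0.
(* The squared norm of |v| u - |u| v is nonnegative. *)
have := hnorm_sqrD ((hnorm v)%:C%C *: u) (- (hnorm u)%:C%C *: v).
rewrite linearZl_LR linearZr_LR/= !hnormZ normcN.
rewrite !normc_real ?hnorm_ge0//.
have := sqr_ge0 (hnorm ((hnorm v)%:C%C *: u + - (hnorm u)%:C%C *: v)).
move=> /[swap] ->; case: (hdot V u v) => a b /=; simpc => /= H.
have uv := mulr_gt0 u1 v1.
rewrite -(ler_pM2l uv); nra.
Qed.

Lemma hnormD u v : hnorm (u + v) <= hnorm u + hnorm v.
Proof.
rewrite -(@ler_pXn2r _ 2%N) ?nnegrE ?addr_ge0 ?hnorm_ge0//.
rewrite hnorm_sqrD; have := Re_hdot_le u v; lra.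
Qed.

Lemma hnormB u v : hnorm (u - v) <= hnorm u + hnorm v.
Proof. by rewrite -(hnormN v); exact: hnormD. Qed.

Lemma hdot_le u v : normc (hdot V u v) <= hnorm u * hnorm v.
Proof.
have := Re_hdot_le ((hdot V u v)^* *: u) v.
rewrite linearZl_LR /= hnormZ; case: (hdot V u v) => a b /=.
rewrite -mulrA sqrrN; set n := Num.sqrt _.
have -> : a * a - - b * b = n ^+ 2.
  by rewrite sqr_sqrtr ?addr_ge0 ?sqr_ge0//; ring.
have n0 : 0 <= n by exact: sqrtr_ge0.
move=> h; have [->|n1] := eqVneq n 0; first by rewrite mulr_ge0 ?hnorm_ge0.
have n2 : 0 < n by rewrite lt_def n1.
by rewrite -(ler_pM2l n2) -expr2.
Qed.

(** Pythagoras. *)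
Lemma hnorm_sqr_sum (I : eqType) (s : seq I) (f : I -> V) : uniq s ->
  {in s &, forall i j, i != j -> hdot V (f i) (f j) = 0} ->
  hnorm (\sum_(i <- s) f i) ^+ 2 = \sum_(i <- s) hnorm (f i) ^+ 2.
Proof.
elim: s => [|i s IH] /=; first by rewrite !big_nil hnorm0 expr0n.
move=> /andP[nis us] orth; rewrite !big_cons hnorm_sqrD IH//; last first.
  by move=> j k js ks; apply: orth; rewrite inE ?js ?ks orbT.
rewrite (_ : hdot V _ _ = 0) ?mulr0 ?addr0// linear_sumr big_seq big1// => j js.
apply: orth; rewrite ?inE ?eqxx ?js ?orbT//.
by apply: contraNneq nis => ->.
Qed.

End hilbert_norm.

(** * The group algebra acting in a representation *)

Section group_algebra.
Variables (R : realType) (Gam : groupType).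
Implicit Types (pi rho : unitary_rep R Gam) (s t : seq (R[i] * Gam)).

(** A list of pairs (coefficient, group element) stands for the element of the
    group algebra that it sums to: products and differences are then list
    operations, with no bookkeeping of supports. *)
Definition comb pi s (u : rep_space pi) : rep_space pi :=
  \sum_(p <- s) p.1 *: pi p.2 u.

Definition augmentation s : R[i] := \sum_(p <- s) p.1.

Definition comb_mul s t := [seq (p.1 * q.1, (p.2 * q.2)%g) | p <- s, q <- t].

Definition comb_sub s t := s ++ [seq (- p.1, p.2) | p <- t].

Definition comb_exp s n := iter n (comb_mul s) [:: (1, 1%g)].

Lemma hnorm_rep pi g (u : rep_space pi) : hnorm (pi g u) = hnorm u.
Proof. by rewrite /hnorm /dnorm rep_op_dot. Qed.

Lemma comb_is_linear pi s : linear (@comb pi s).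
Proof.
move=> c u v; rewrite /comb scaler_sumr -big_split; apply: eq_bigr => p _ /=.
by rewrite linearP scalerDr !scalerA mulrC.
Qed.

HB.instance Definition _ pi s :=
  GRing.isLinear.Build R[i] (rep_space pi) (rep_space pi) _ (@comb pi s)
    (@comb_is_linear pi s).

Lemma comb1 pi g (u : rep_space pi) : comb [:: (1, g)] u = pi g u.
Proof. by rewrite /comb big_seq1 scale1r. Qed.

Lemma comb_mulE pi s t (u : rep_space pi) :
  comb (comb_mul s t) u = comb s (comb t u).
Proof.
rewrite /comb big_allpairs_dep; apply: eq_bigr => p _ /=.
rewrite linear_sum scaler_sumr; apply: eq_bigr => q _ /=.
by rewrite rep_opM linearZ scalerA.
Qed.

Lemma comb_subE pi s t (u : rep_space pi) :
  comb (comb_sub s t) u = comb s u - comb t u.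
Proof.
rewrite /comb big_cat big_map -sumrN; congr (_ + _).
by apply: eq_bigr => p _; rewrite scaleNr.
Qed.

Lemma comb_expE pi s n (u : rep_space pi) :
  comb (comb_exp s n) u = iter n (@comb pi s) u.
Proof.
by elim: n => [|n IH] /=; rewrite ?comb1 ?rep_op1// comb_mulE IH.
Qed.

Lemma comb_fixed pi s (u : rep_space pi) :
  (forall g, pi g u = u) -> comb s u = augmentation s *: u.
Proof.
by move=> fu; rewrite scaler_suml; apply: eq_bigr => p _; rewrite fu.
Qed.

Lemma rep_algE pi (a : group_alg R Gam) (u : rep_space pi) :
  rep_alg a u = comb [seq (a g, g) | g <- finsupp a] u.
Proof. by rewrite /comb big_map. Qed.

(** Lists may repeat group elements; collecting the coefficients of equal
    elements turns them into honest elements of the group algebra. *)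
Lemma comb_rep_alg s : exists a : group_alg R Gam,
  forall pi (u : rep_space pi), rep_alg a u = comb s u.
Proof.
pose S := seq_fset tt [seq p.2 | p <- s].
pose a : group_alg R Gam := [fsfun g in S => \sum_(p <- s | p.2 == g) p.1].
exists a => pi u; rewrite /rep_alg.
have aE g : a g = \sum_(p <- s | p.2 == g) p.1.
  rewrite fsfunE; case: ifPn => // gS; rewrite big_seq_cond big1// => p.
  move=> /andP[ps /eqP pg]; move: gS; rewrite seq_fsetE => /negP[].
  by apply/mapP; exists p.
rewrite (big_fset_incl _ (B := S)); last 2 first.
- by apply/fsubsetP => g; rewrite mem_finsupp fsfunE; case: ifPn => //; rewrite eqxx.
- by move=> g _; rewrite memNfinsupp => /eqP ->; rewrite scale0r.
rewrite /comb; under eq_bigr do rewrite aE scaler_suml.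
rewrite (exchange_big_dep xpredT)//= [LHS]big_seq [RHS]big_seq.
apply: eq_bigr => p ps; under eq_bigl do rewrite eq_sym.
have pS : p.2 \in S by rewrite seq_fsetE map_f.
rewrite -big_filter (_ : seq.filter _ _ = [:: p.2]) ?big_seq1//.
by apply: filter_pred1_uniq; rewrite ?sort_keys_uniq ?sort_keysE ?map_f.
Qed.

End group_algebra.

(** * Weak containment *)

Section weak_containment.
Variables (R : realType) (Gam : groupType).
Implicit Types (pi rho : unitary_rep R Gam) (s : seq (R[i] * Gam)).

(** The bound on the unit ball extends to all vectors by homogeneity. *)
Lemma opnorm_leP (V : hilbert R) (T : {linear V -> V}) (C : R) : 0 <= C ->
  (opnorm T <= C%:E)%E <-> forall u, hnorm (T u) <= C * hnorm u.
Proof.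
move=> C0; split => [TC u|TC]; last first.
  apply: ge_ereal_sup => _ /= [u u1 <-]; rewrite lee_fin.
  by apply: le_trans (TC u) _; rewrite ler_piMr.
have [/hnorm_eq0 ->|u0] := eqVneq (hnorm u) 0.
  by rewrite linear0 hnorm0 mulr0.
have up : 0 < hnorm u by rewrite lt_def u0 hnorm_ge0.
rewrite -ler_pdivrMr// mulrC -{1}[(hnorm u)^-1]normc_real ?invr_ge0 ?hnorm_ge0//.
rewrite -hnormZ -linearZ -lee_fin; apply: le_trans TC.
apply: ereal_sup_ubound; eexists; last reflexivity.
by rewrite /= hnormZ normc_real ?invr_ge0 ?hnorm_ge0// mulVf.
Qed.

(** Elements of the group algebra are elements of the completion, so weak
    containment transfers bounds on them; this is the form in which it is used. *)
Lemma weakly_contained_comb rho pi s (C : R) : weakly_contained rho pi ->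
  0 <= C -> (forall u, hnorm (@comb _ _ pi s u) <= C * hnorm u) ->
  forall u, hnorm (@comb _ _ rho s u) <= C * hnorm u.
Proof.
move=> rhopi C0; have [a aE] := comb_rep_alg s.
have aE' tau : cstar_of a tau = @comb _ _ tau s by apply/funext => u; exact: aE.
have := rhopi (cstar_of a); rewrite !aE' => le_norm.
by rewrite -!opnorm_leP//; exact: le_trans.
Qed.

(** An intertwiner commutes with every element of the group algebra, hence with
    every element of the completion; so a subrepresentation is weakly
    contained. *)
Lemma weakly_contained_isometry rho pi
    (U : {linear rep_space rho -> rep_space pi}) :
  (forall u, hnorm (U u) = hnorm u) ->
  (forall g u, U (rho g u) = pi g (U u)) -> weakly_contained rho pi.
Proof.
move=> isoU UC x.
have xU u : U (x rho u) = x pi (U u).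
  apply/eqP; rewrite -subr_eq0; apply/eqP/hnorm_eq0/eqP.
  rewrite eq_le hnorm_ge0 andbT; apply/ler_addgt0Pl => e e0; rewrite addr0.
  (* Approximating x by a within d costs d |u| on either side. *)
  have [d d0 de] : exists2 d, 0 < d & d * hnorm u + d * hnorm u <= e.
    have n1 : 0 < 2 * (hnorm u + 1) by rewrite mulr_gt0// ltr_wpDl ?hnorm_ge0.
    exists (e / (2 * (hnorm u + 1))); first by rewrite divr_gt0.
    have := divfK (lt0r_neq0 n1) e; have := divr_gt0 e0 n1; lra.
  have [a aP] := cstar_approx x d0.
  have -> : U (x rho u) - x pi (U u) =
      U (x rho u - rep_alg a u) - (x pi (U u) - rep_alg a (U u)).
    rewrite linearB (_ : U (rep_alg a u) = rep_alg a (U u)).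
      by rewrite opprB addrA subrK.
    by rewrite linear_sum; apply: eq_bigr => g _; rewrite linearZ /= UC.
  apply: le_trans (hnormB _ _) _; rewrite isoU; apply: le_trans de.
  by apply: lerD; [exact: aP|rewrite -(isoU u); exact: aP].
apply: ge_ereal_sup => _ /= [u u1 <-]; rewrite -isoU xU.
by apply: ereal_sup_ubound; exists (U u) => //=; rewrite isoU.
Qed.

(** The witness of the spectral gap is an element of the completion; a close
    enough element of the group algebra, rescaled, still separates. *)
Lemma spectral_gap_comb pi : ~ weakly_contained (trivial_rep R Gam) pi ->
  exists s, augmentation s = 1 /\ exists r : R, [/\ 0 <= r, r < 1 &
    forall u, hnorm (@comb _ _ pi s u) <= r * hnorm u].
Proof.
move=> /existsNP[x /negP]; rewrite -ltNge => gap.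
pose triv := trivial_rep R Gam.
have [u u1 gapu] : exists2 u : rep_space triv, hnorm u <= 1 &
    (opnorm (x pi) < (hnorm (x triv u))%:E)%E.
  by have [_ [u u1 <-] gapu] := ereal_sup_gt gap; exists u.
have M0 : (0 <= opnorm (x pi))%E.
  apply: (@le_trans _ _ (hnorm (x pi 0))%:E); first by rewrite lee_fin hnorm_ge0.
  by apply: ereal_sup_ubound; exists 0; rewrite //= hnorm0.
move: gapu M0; case ME : (opnorm (x pi)) => [M| |]//; rewrite lte_fin lee_fin.
set N := hnorm (x triv u) => MN M0.
(* Errors of e on both sides still leave M + e < N - e. *)
pose e := (N - M) / 3; have e0 : 0 < e by rewrite /e; lra.
have [a aP] := cstar_approx x e0.
pose c := augmentation [seq (a g, g) | g <- finsupp a].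
have cN : N - e <= normc c.
  have := aP triv u; rewrite rep_algE comb_fixed// -/c => ax.
  have : N <= hnorm (x triv u - c *: u) + hnorm (c *: u).
    by apply: le_trans (hnormD _ _); rewrite subrK.
  rewrite hnormZ => h.
  have := ler_wpM2l (normc_ge0 c) u1; have := ler_wpM2l (ltW e0) u1; lra.
have Me0 : 0 <= M + e by rewrite addr_ge0// ltW.
have aM : forall v, hnorm (@comb _ _ pi [seq (a g, g) | g <- finsupp a] v)
    <= (M + e) * hnorm v.
  apply/(opnorm_leP _ Me0); apply: ge_ereal_sup => _ /= [v v1 <-].
  rewrite lee_fin -rep_algE.
  have : hnorm (x pi v) <= M.
    by rewrite -lee_fin -ME; apply: ereal_sup_ubound; exists v.
  have := aP _ v; rewrite -hnormN opprB => av xv.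
  have := hnormD (rep_alg a v - x pi v) (x pi v); rewrite subrK.
  have := ler_wpM2l (ltW e0) v1; lra.
have c0 : 0 < normc c by apply: lt_le_trans cN; rewrite /e; lra.
have cn0 : c != 0 by apply: contraTneq c0 => ->; rewrite normc0 ltxx.
exists [seq (c^-1 * a g, g) | g <- finsupp a]; split.
  rewrite /augmentation big_map /= -mulr_sumr.
  by rewrite -[X in _ * X](big_map (fun g => (a g, g)) xpredT fst) mulVf.
exists ((M + e) / normc c); split; first by rewrite divr_ge0// ltW.
  rewrite ltr_pdivrMr// mul1r; apply: lt_le_trans cN; rewrite /e; lra.
move=> v; have -> : comb [seq (c^-1 * a g, g) | g <- finsupp a] v =
    c^-1 *: comb [seq (a g, g) | g <- finsupp a] v.
  rewrite /comb !big_map scaler_sumr; apply: eq_bigr => g _ /=.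
  by rewrite scalerA.
by rewrite hnormZ normcV mulrC mulrAC ler_pM2r ?invr_gt0.
Qed.

End weak_containment.

(** * Transfer of the base vector *)

Section transfer.
Variables (R : realType) (G : groupType).
Implicit Types (pi : unitary_rep R G) (s : seq (R[i] * G)).

(** The adjoint of the element fixes u up to the conjugate of the coefficient
    sum, since inverses also fix u. *)
Lemma hdot_comb_fixed pi s (w u : rep_space pi) :
  (forall p, p \in s -> pi p.2 u = u) ->
  hdot _ (comb s w) u = augmentation s * hdot _ w u.
Proof.
move=> fu; rewrite linear_sumlz /augmentation mulr_suml big_seq [RHS]big_seq.
apply: eq_bigr => p ps; rewrite linearZl_LR /=; congr (_ * _).
by rewrite -[in LHS](fu p ps) rep_op_dot.
Qed.

Lemma iter_comb_linear pi s n : linear (iter n (@comb _ _ pi s)).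
Proof. by elim: n => // n IH c u v; rewrite /= IH linearP. Qed.

(** In this section A n converges in norm to the orthogonal projection onto the
    line of e, at speed r^n.  The three corollaries after
    [iter_comb_projection] record consequences that are norm bounds on single
    elements of the group algebra. *)
Section compressed.
Variables (pi : unitary_rep R G) (H : set G) (e : rep_space pi).
Variables (s : seq (R[i] * G)) (r : R).
Hypothesis e1 : hnorm e = 1.
Hypothesis He : forall h, H h -> pi h e = e.
Hypothesis Hperp : forall g, ~ H g -> hdot _ (pi g e) e = 0.
Hypothesis sH : forall p, p \in s -> H p.2.
Hypothesis s1 : augmentation s = 1.
Hypotheses (r0 : 0 <= r) (r1 : r < 1).
Hypothesis gap : forall u, hdot _ u e = 0 -> hnorm (comb s u) <= r * hnorm u.

Local Notation A n := (iter n (@comb _ _ pi s)).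

Lemma iter_gap n u : hdot _ u e = 0 -> hnorm (A n u) <= r ^+ n * hnorm u.
Proof.
move=> ue; have : hdot _ (A n u) e = 0 /\ hnorm (A n u) <= r ^+ n * hnorm u.
  elim: n => [|n [IH1 IH2]] /=; first by rewrite mul1r.
  rewrite hdot_comb_fixed => [|p /sH/He//]; rewrite IH1 mulr0; split => //.
  apply: le_trans (gap IH1) _; rewrite exprS -mulrA.
  exact: ler_wpM2l.
by case.
Qed.

Lemma iter_comb_fixed n : A n e = e.
Proof.
elim: n => //= n ->; rewrite -[RHS]scale1r -s1 scaler_suml /comb.
by rewrite big_seq [RHS]big_seq; apply: eq_bigr => p /sH/He ->.
Qed.

Lemma iter_comb_projection n u :
  hnorm (A n u - hdot _ u e *: e) <= 2 * r ^+ n * hnorm u.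
Proof.
have u0 : hdot _ (u - hdot _ u e *: e) e = 0.
  by rewrite linearBl /= linearZl_LR /= hdot_sqr e1 expr1n mulr1 subrr.
have -> : A n u - hdot _ u e *: e = A n (u - hdot _ u e *: e).
  have := iter_comb_linear s n (- hdot _ u e) e u.
  by rewrite iter_comb_fixed !scaleNr addrC => <-; rewrite addrC.
apply: le_trans (iter_gap n u0) _; rewrite [2 * _]mulrC -mulrA.
apply: ler_wpM2l; first exact: exprn_ge0.
apply: le_trans (hnormB _ _) _; rewrite mulrDl mul1r lerD2l hnormZ e1 mulr1.
by apply: le_trans (hdot_le _ _) _; rewrite e1 mulr1.
Qed.

Let rn n : 0 <= r ^+ n. Proof. exact: exprn_ge0. Qed.

Lemma iter_comb_cauchy m n u : (m <= n)%N ->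
  hnorm (A n u - A m u) <= 4 * r ^+ m * hnorm u.
Proof.
move=> mn; have := iter_comb_projection n u; have := iter_comb_projection m u.
set c := _ *: e => hm hn.
have -> : A n u - A m u = (A n u - c) - (A m u - c) by rewrite opprB addrA subrK.
apply: le_trans (hnormB _ _) _.
have : r ^+ n * hnorm u <= r ^+ m * hnorm u.
  by apply: ler_wpM2r; [exact: hnorm_ge0|apply: ler_wiXn2l => //; exact: ltW].
lra.
Qed.

Lemma iter_comb_invariant h n u : H h ->
  hnorm (pi h (A n u) - A n u) <= 4 * r ^+ n * hnorm u.
Proof.
move=> Hh; have := iter_comb_projection n u; set c := hdot _ _ _ => hn.
have -> : pi h (A n u) - A n u = pi h (A n u - c *: e) - (A n u - c *: e).
  by rewrite linearB linearZ /= He// opprB addrA subrK.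
apply: le_trans (hnormB _ _) _; rewrite hnorm_rep; lra.
Qed.

Lemma iter_comb_orthogonal g n u : ~ H g ->
  hnorm (A n (pi g (A n u))) <= 8 * r ^+ n * hnorm u.
Proof.
move=> Hg; set c := hdot _ u e.
have cu : normc c <= hnorm u by have := hdot_le u e; rewrite e1 mulr1.
have rn1 : r ^+ n <= 1 by apply: exprn_ile1 => //; exact: ltW.
have -> : A n (pi g (A n u)) = c *: A n (pi g e) + A n (pi g (A n u - c *: e)).
  by rewrite -iter_comb_linear -linearP addrC subrK.
apply: le_trans (hnormD _ _) _; rewrite hnormZ.
have h1 := iter_gap n (Hperp Hg); rewrite hnorm_rep e1 mulr1 in h1.
have h2 := iter_comb_projection n u; rewrite -/c in h2.
pose w := pi g (A n u - c *: e).
(* Boundedness of A n uniformly in n, also from the projection estimate. *)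
have h3 : hnorm (A n w) <= 3 * hnorm w.
  rewrite -[A n w](subrK (hdot _ w e *: e)).
  apply: le_trans (hnormD _ _) _; rewrite hnormZ e1 mulr1.
  have := hdot_le w e; have := iter_comb_projection n w; rewrite e1 mulr1.
  have := ler_wpM2r (hnorm_ge0 w) rn1; lra.
rewrite /w hnorm_rep in h3.
have := ler_pM (normc_ge0 c) (hnorm_ge0 _) cu h1.
have := mulr_ge0 (rn n) (hnorm_ge0 u).
lra.
Qed.

End compressed.

Variables (sigma tau : unitary_rep R G) (H : set G) (e : rep_space sigma).
Variables (s : seq (R[i] * G)) (r : R).

(** The limit of the powers of the element s in tau is nonzero on some vector
    because the norms of these powers are at least 1 in sigma. *)
Lemma transfer_vector :
  weakly_equivalent sigma tau ->
  hnorm e = 1 -> (forall h, H h -> sigma h e = e) ->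
  (forall g, ~ H g -> hdot _ (sigma g e) e = 0) ->
  (forall p, p \in s -> H p.2) -> augmentation s = 1 -> 0 <= r -> r < 1 ->
  (forall u : rep_space sigma, hdot _ u e = 0 ->
    hnorm (comb s u) <= r * hnorm u) ->
  exists v : rep_space tau, [/\ v != 0,
    forall h, H h -> tau h v = v &
    forall g, ~ H g -> hdot _ (tau g v) v = 0].
Proof.
move=> [st ts] e1 He Hperp sH s1 r0 r1 gap.
pose T n := iter n (@comb _ _ tau s).
have rn n : 0 <= r ^+ n by exact: exprn_ge0.
have cauchyT m n u : (m <= n)%N -> hnorm (T n u - T m u) <= 4 * r ^+ m * hnorm u.
  move=> mn; rewrite /T -!comb_expE -comb_subE; apply: weakly_contained_comb u => //.
    by rewrite mulr_ge0.
  move=> u; rewrite comb_subE !comb_expE.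
  exact: (iter_comb_cauchy e1 He sH s1 r0 r1 gap).
have invT h n u : H h -> hnorm (tau h (T n u) - T n u) <= 4 * r ^+ n * hnorm u.
  move=> Hh; rewrite /T -!comb_expE -comb1 -comb_mulE -comb_subE.
  apply: weakly_contained_comb u => //; first by rewrite mulr_ge0.
  move=> u; rewrite comb_subE comb_mulE comb1 !comb_expE.
  exact: (iter_comb_invariant e1 He sH s1 r0 gap).
have orthT g n u : ~ H g -> hnorm (T n (tau g (T n u))) <= 8 * r ^+ n * hnorm u.
  move=> Hg; rewrite /T -!comb_expE -comb1 -!comb_mulE.
  apply: weakly_contained_comb u => //; first by rewrite mulr_ge0.
  move=> u; rewrite !comb_mulE comb1 !comb_expE.
  exact: (iter_comb_orthogonal e1 He Hperp sH s1 r0 r1 gap).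
(* Past the index m, the powers move a vector by less than an eighth of its
   norm, so a vector that the m-th power shrinks by at most half has a nonzero
   limit. *)
have [m rm] : exists m, 8 * r ^+ m < 1 / 4.
  apply: contrapT => /forallNP nm; have : (1 / 4 : R) <= 0; last by lra.
  by apply: (geometric_le0 (C := 8) r0 r1) => n; rewrite leNgt; apply/negP/nm.
have [u Tu] : exists u, 1 / 2 * hnorm u < hnorm (T m u).
  apply: contrapT => /forallNP nu; have : hnorm e <= 1 / 2 * hnorm e; last first.
    by rewrite e1; lra.
  rewrite -[in leLHS](iter_comb_fixed He sH s1 m) -comb_expE.
  apply: weakly_contained_comb e => //.
  by move=> u; rewrite comb_expE leNgt; apply/negP/nu.
have u0 : 0 < hnorm u.
  rewrite lt_def hnorm_ge0 andbT; apply: contraTneq Tu => /hnorm_eq0 ->.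
  by rewrite -leNgt /T -comb_expE linear0 hnorm0 mulr0.
have [v vP] : exists v, forall d : R, 0 < d -> exists N, forall n, (N <= n)%N ->
    dnorm (hdot (rep_space tau)) (T n u - v) < d.
  apply: hilbert_complete => d d0.
  have [N rN] : exists N, 8 * hnorm u * r ^+ N < d.
    apply: contrapT => /forallNP nN; have : d <= 0; last by rewrite leNgt d0.
    by apply: (geometric_le0 r0 r1) => n; rewrite leNgt; apply/negP/nN.
  exists N => i j Ni Nj; rewrite -/(hnorm _).
  have -> : T i u - T j u = (T i u - T N u) - (T j u - T N u).
    by rewrite opprB addrA subrK.
  apply: le_lt_trans (hnormB _ _) _; apply: le_lt_trans rN.
  have := cauchyT N i u Ni; have := cauchyT N j u Nj; lra.
have Tv n : hnorm (T n u - v) <= 4 * r ^+ n * hnorm u.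
  apply/ler_addgt0Pl => d /vP[N NP].
  have -> : T n u - v = (T (maxn n N) u - v) - (T (maxn n N) u - T n u).
    by rewrite opprB [RHS]addrC addrA subrK.
  apply: le_trans (hnormB _ _) _; apply: lerD.
    exact/ltW/NP/leq_maxr.
  exact/cauchyT/leq_maxl.
have v0 : v != 0.
  apply/eqP => v0; have := Tv m; rewrite v0 subr0.
  have := ler_wpM2r (hnorm_ge0 u) (ltW rm); lra.
have Hv h : H h -> tau h v = v.
  move=> Hh; apply/eqP; rewrite -subr_eq0; apply/eqP/hnorm_eq0/eqP.
  rewrite eq_le hnorm_ge0 andbT.
  apply: (geometric_le0 (C := 12 * hnorm u) r0 r1) => n.
  have -> : tau h v - v =
      (tau h (T n u) - T n u) - (tau h (T n u - v) - (T n u - v)).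
    rewrite [tau h (_ - _)]linearB !opprB addrA [X in _ = X + _]addrA subrK.
    by rewrite [RHS]addrC addrA subrK.
  apply: le_trans (hnormB _ _) _; have := hnormB (tau h (T n u - v)) (T n u - v).
  have := invT h n u Hh; have := Tv n; rewrite hnorm_rep; lra.
exists v; split => // g Hg; apply: normc_eq0.
apply: (geometric_le0 (C := 8 * hnorm v * hnorm v) r0 r1) => n.
(* T^n v = v and, taking adjoints, <T^n w, v> = <w, v>; hence <g v, v> equals
   <T^n g T^n v, v>, which is O(r^n). *)
have Tvv w : hdot _ (T n w) v = hdot _ w v.
  rewrite /T; elim: n => //= k IH.
  by rewrite hdot_comb_fixed => [|p /sH/Hv//]; rewrite s1 mul1r.
have fv : T n v = v by exact: (iter_comb_fixed Hv sH s1).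
rewrite -Tvv -{1}fv; apply: le_trans (hdot_le _ _) _.
have := ler_wpM2r (hnorm_ge0 v) (orthT g n v Hg); lra.
Qed.

End transfer.

(** * Square summable functions *)

Section square_summable.
Variables (R : realType) (X : choiceType).
Implicit Types (f w : ell2 R X) (S : set X).

Fact indicator_ell2 S : finite_set S ->
  (fun x => (x \in S)%:R : R[i]) \in @ell2_pred R X.
Proof.
move=> finS; apply/asboolP; rewrite rsummableE.
rewrite (_ : esum _ _ = \esum_(x in S) 1%:E)%E.
  by rewrite esum_fset// fsbig_finite//= sumEFin ltry.
rewrite [RHS]esum_mkcond; apply: eq_esum => x _.
by case: (x \in S); rewrite /sqmod /= ?expr1n ?expr0n /= addr0 ?normr1 ?normr0.
Qed.

Definition indicator S (finS : finite_set S) : ell2 R X :=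
  Ell2 (indicator_ell2 finS).

Lemma indicatorE S (finS : finite_set S) x :
  indicator finS x = (x \in S)%:R.
Proof. by []. Qed.

Lemma rsum_single (x : X) (g : X -> R) :
  (forall y, y != x -> g y = 0) -> rsum g = g x.
Proof.
move=> g0; have single (h : X -> \bar R) : (0 <= h x)%E ->
    (forall y, y != x -> h y = 0%E) -> (\esum_(y in [set: X]) h y = h x)%E.
  move=> hx h0; rewrite -(esum_set1 hx) [RHS]esum_mkcond.
  apply: eq_esum => y _; rewrite in_set1; case: eqVneq => [->//|/h0//].
rewrite /rsum !single ?funepos_ge0 ?funeneg_ge0//.
- rewrite funeposE funenegE /= -!EFin_max /=.
  by rewrite /Num.max; do 2 case: ifPn => ?; lra.
- by move=> y /g0 gy; rewrite funenegE /= gy oppr0 maxxx.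
- by move=> y /g0 gy; rewrite funeposE /= gy maxxx.
Qed.

Lemma hdot_indicator1 f (x : X) :
  hdot (ell2_hilbert R X) f (indicator (finite_set1 x)) = f x.
Proof.
rewrite -[LHS]/(csum (fun y => f y * (indicator (finite_set1 x) y)^*)).
have z y : y != x -> f y * (indicator (finite_set1 x) y)^* = 0.
  by move=> yx; rewrite indicatorE in_set1 (negbTE yx) conjC0 mulr0.
rewrite /csum !(rsum_single (x := x)) => [|y /z ->//|y /z ->//].
by rewrite indicatorE in_set1 eqxx conjC1 mulr1; case: (f x).
Qed.

Lemma hnorm_ell2E f : hnorm (f : ell2_hilbert R X) =
  Num.sqrt (fine (\esum_(x in [set: X]) (sqmod (f x))%:E)%E).
Proof. exact: dnorm_ell2E. Qed.

Lemma sqmod_le_hnorm f x : sqmod (f x) <= hnorm (f : ell2_hilbert R X) ^+ 2.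
Proof.
have := sqmod_le_dot f x.
have := @hdot_sqr R (ell2_hilbert R X) f => /(congr1 (@complex.Re R)) /= <-.
by [].
Qed.

(** Infinitely many values of constant positive modulus are not square
    summable. *)
Lemma ell2_level_finite f (c : R[i]) : c != 0 -> finite_set [set x | f x = c].
Proof.
move=> c0; apply: (bounded_card_finite (M := hnorm (f : ell2_hilbert R X) ^+ 2)
  (sqmod_gt0 c0)) => B Bc.
rewrite hnorm_ell2E sqr_sqrtr; last first.
  by apply: fine_ge0; apply: esum_ge0 => x _; rewrite lee_fin sqmod_ge0.
rewrite -lee_fin fineK ?ell2_esum_fin//; apply: esum_ge.
exists [set` B]; first by split.
rewrite fsbig_finite//= set_fsetK sumEFin lee_fin.
rewrite [leRHS]big_seq (eq_bigr (fun=> sqmod c)) => [|x xB]; last first.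
  by rewrite (Bc x xB).
by rewrite -big_seq big_const_seq count_predT iter_addr_0 mulr_natl.
Qed.

End square_summable.

(** * The base coset and the spectral gap *)

Section base_coset.
Variables (R : realType) (G : groupType) (H : groupClosed G).

Fact base_coset_subproof : is_left_coset H [set` H].
Proof. by apply/asboolP; exists 1%g; rewrite left_translate1. Qed.

Definition base_coset : cosets H := Sub [set` H] base_coset_subproof.

Lemma left_translate_sub (h : G) : h \in H -> left_translate h [set` H] = [set` H].
Proof.
move=> Hh; apply/seteqP; split=> [_ [x /= Hx <-]|x /= Hx].
  by rewrite /= gpredMl.
by exists (h^-1 * x)%g; rewrite ?mulVKg//= gpredMl ?gpredV.
Qed.

Lemma left_translate_eqP (g k : G) :
  left_translate g [set` H] = left_translate k [set` H] <-> (g^-1 * k)%g \in H.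
Proof.
split=> [gk|Hgk]; last first.
  by rewrite -[k](mulVKg g) left_translateM (left_translate_sub Hgk).
have : left_translate k [set` H] k by exists 1%g; rewrite ?mulg1//= gpred1.
by rewrite -gk => -[x /= Hx <-]; rewrite mulKg.
Qed.

Lemma coset_translate_base (g : G) :
  (coset_translate g base_coset == base_coset) = (g \in H).
Proof.
apply/eqP/idP => [/(congr1 val)/=|Hg]; last first.
  by apply: val_inj; exact: left_translate_sub.
rewrite -[RHS](left_translate1) => /left_translate_eqP.
by rewrite mulg1 gpredV.
Qed.

Definition base_vector : rep_space (quasi_regular R H) :=
  indicator R (finite_set1 base_coset).

Lemma hdot_base_vector u : hdot _ u base_vector = (u : ell2 _ _) base_coset.
Proof. exact: hdot_indicator1. Qed.

Lemma hnorm_base_vector : hnorm base_vector = 1.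
Proof.
have := hdot_base_vector base_vector; rewrite hdot_sqr indicatorE in_set1 eqxx.
move=> /(congr1 (@complex.Re R)) /= /eqP.
by rewrite sqrp_eq1 ?hnorm_ge0// => /eqP.
Qed.

Lemma base_vector_fixed h : h \in H -> quasi_regular R H h base_vector = base_vector.
Proof.
move=> Hh; apply: ell2_ext => x.
rewrite -[LHS]/(indicator R (finite_set1 base_coset) (coset_translate h^-1%g x)).
rewrite !indicatorE !in_set1; congr (nat_of_bool _)%:R.
have /eqP hb : coset_translate h base_coset == base_coset.
  by rewrite coset_translate_base.
apply/eqP/eqP => [xb|->].
  by rewrite -hb -xb -coset_translateM mulgV coset_translate1.
by rewrite -{1}hb -coset_translateM mulVg coset_translate1.
Qed.

Lemma base_vector_orthogonal g : g \notin H ->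
  hdot _ (quasi_regular R H g base_vector) base_vector = 0.
Proof.
move=> Hg; rewrite hdot_base_vector.
rewrite -[LHS]/(indicator R (finite_set1 base_coset)
  (coset_translate g^-1%g base_coset)).
by rewrite indicatorE in_set1 coset_translate_base gpredV (negbTE Hg).
Qed.

Fact restrict_ell2 (u : ell2 R (cosets H)) :
  (fun A : nontrivial_cosets H => u (val A)) \in @ell2_pred R (nontrivial_cosets H).
Proof.
apply/asboolP; rewrite rsummableE; apply: le_lt_trans (ell2P u).
rewrite -(esum_image [set: nontrivial_cosets H] val (fun x => `|sqmod (u x)|%:E)).
  rewrite esum_mkcond; apply: le_esum => x _; case: ifP => //= _.
by move=> x y _ _; exact: val_inj.
Qed.

(** Restriction is isometric on the orthogonal complement of the base vector, and
    intertwines the actions of H; it identifies that complement with the space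
    in which the spectral gap is formulated. *)
Definition restrict u : ell2 R (nontrivial_cosets H) := Ell2 (restrict_ell2 u).

Lemma hnorm_restrict (u : ell2 R (cosets H)) : u base_coset = 0 ->
  hnorm (restrict u : ell2_hilbert R _) = hnorm (u : ell2_hilbert R _).
Proof.
move=> u0; rewrite !hnorm_ell2E; congr (Num.sqrt (fine _)).
rewrite -(esum_image [set: nontrivial_cosets H] val (fun x => (sqmod (u x))%:E)).
  rewrite esum_mkcond; apply: eq_esum => x _; case: ifPn => //= xN.
  suff -> : x = base_coset by rewrite u0 /sqmod /= expr0n addr0.
  apply: val_inj; apply/eqP; apply: contraNT xN => xN.
  by apply/mem_set; exists (Sub x xN).
by move=> x y _ _; exact: val_inj.
Qed.

Local Notation lambda := (quasi_regular R H).
Local Notation lambda' := (permutation_rep R (nontrivial_coset_action H)).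

Lemma restrict_comb (s : seq (R[i] * subgroup H)) (u : rep_space lambda) :
  restrict (comb [seq (p.1, val p.2) | p <- s] u) =
  comb s (restrict u : rep_space lambda').
Proof.
have restrictP c (f g : rep_space lambda) :
    restrict (c *: f + g) = c *: (restrict f : rep_space lambda') + restrict g.
  by apply: ell2_ext.
rewrite /comb big_map; elim: s => [|p s IH].
  by rewrite !big_nil; apply: ell2_ext.
rewrite !big_cons restrictP IH; congr (_ *: _ + _).
by apply: ell2_ext.
Qed.

(** The spectral gap, read inside the quasi-regular representation of G. *)
Lemma Sub_sg_comb : Sub_sg R H -> exists s : seq (R[i] * G),
  [/\ augmentation s = 1, forall p, p \in s -> p.2 \in H &
  exists r : R, [/\ 0 <= r, r < 1 &
    forall u : rep_space (quasi_regular R H), hdot _ u base_vector = 0 ->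
      hnorm (comb s u) <= r * hnorm u]].
Proof.
move=> /spectral_gap_comb [s [s1 [r [r0 r1 gap]]]].
exists [seq (p.1, val p.2) | p <- s].
have sH p : p \in [seq (p.1, val p.2) | p <- s] -> p.2 \in H.
  by move=> /mapP[q _ ->] /=; exact: valP.
split => //; first by rewrite /augmentation big_map.
exists r; split => // u ue.
rewrite -(hnorm_restrict (u := u)); last by rewrite -hdot_base_vector.
rewrite -hnorm_restrict ?restrict_comb; first exact: gap.
rewrite -hdot_base_vector hdot_comb_fixed ?ue ?mulr0// => p /sH.
exact: base_vector_fixed.
Qed.

End base_coset.

(** * Commensurability *)

Section commensurability.
Variable G : groupType.
Implicit Types (A B C : set G) (H L : groupClosed G).

Definition is_subgroup A := A 1%g /\ forall x y, A x -> A y -> A (x^-1 * y)%g.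

Lemma is_subgroupV A x : is_subgroup A -> A x -> A x^-1%g.
Proof. by move=> [A1 AM] Ax; rewrite -[x^-1%g]mulg1; exact: AM. Qed.

Lemma is_subgroupM A x y : is_subgroup A -> A x -> A y -> A (x * y)%g.
Proof.
by move=> sA Ax Ay; rewrite -[x]invgK; apply: (proj2 sA) => //; exact: is_subgroupV.
Qed.

Lemma groupClosed_is_subgroup H : is_subgroup [set` H].
Proof. by split=> [|x y /= Hx Hy] /=; rewrite ?gpred1 ?gpredM ?gpredV. Qed.

Lemma conj_setP g A x : conj_set g A x <-> A (g^-1 * x * g)%g.
Proof.
split=> [[a Aa <-]|Ax]; first by rewrite !mulgA mulVg mul1g mulgVK.
by exists (g^-1 * x * g)%g; rewrite // !mulgA mulgV mul1g mulgK.
Qed.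

Lemma conj_setM g h A : conj_set g (conj_set h A) = conj_set (g * h)%g A.
Proof.
apply/seteqP; split=> x; rewrite !conj_setP invgM !mulgA //.
Qed.

Lemma conj_set1 A : conj_set 1%g A = A.
Proof. by apply/seteqP; split=> x; rewrite conj_setP invg1 mul1g mulg1. Qed.

Lemma conj_set_subgroup g A : is_subgroup A -> is_subgroup (conj_set g A).
Proof.
move=> [A1 AM]; split=> [|x y]; first by rewrite conj_setP mulg1 mulVg.
rewrite !conj_setP => Ax Ay; have := AM _ _ Ax Ay.
by rewrite !invgM invgK !mulgA mulgK.
Qed.

Lemma conj_set_stable g A : is_subgroup A -> A g -> conj_set g A = A.
Proof.
move=> sA Ag; apply/seteqP; split=> x.
  move=> [a Aa <-]; apply: is_subgroupM => //; last exact: is_subgroupV.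
  exact: is_subgroupM.
by rewrite conj_setP => Ax; apply: is_subgroupM => //; exact: (proj2 sA).
Qed.

Lemma setI_subgroup A B : is_subgroup A -> is_subgroup B -> is_subgroup (A `&` B).
Proof.
move=> [A1 AM] [B1 BM]; split=> // x y [Ax Bx] [Ay By].
by split; [exact: AM|exact: BM].
Qed.

(** [finite_index A B] makes sense for A not contained in B: it says that
    finitely many cosets of A cover B.  Covering, unlike the index, composes
    without any inclusion. *)
Lemma finite_indexP A B : is_subgroup A ->
  finite_index A B <->
  exists2 F : set G, finite_set F &
    forall b, B b -> exists2 f, F f & A (f^-1 * b)%g.
Proof.
move=> sA; have [A1 AM] := sA; split=> [fAB|[F finF BF]].
  exists [set xget 1%g c | c in [set left_translate b A | b in B]].
    exact: finite_image.
  move=> b Bb; exists (xget 1%g (left_translate b A)).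
    by exists (left_translate b A) => //; exists b.
  have : left_translate b A (xget 1%g (left_translate b A)).
    by apply: (@xgetPex _ 1%g); exists b, 1%g; rewrite ?mulg1.
  by move=> [a Aa <-]; rewrite invgM mulgVK; exact: is_subgroupV.
apply: (@sub_finite_set _ _ [set left_translate f A | f in F]); last first.
  exact: finite_image.
move=> _ [b Bb <-]; have [f Ff Afb] := BF b Bb; exists f => //.
apply/seteqP; split=> _ [a Aa <-].
  exists ((f^-1 * b)^-1 * a)%g; first exact: AM.
  by rewrite invgM invgK !mulgA mulgV mul1g.
exists (f^-1 * b * a)%g; first exact: is_subgroupM.
by rewrite !mulgA mulgV mul1g.
Qed.

Lemma finite_index_trans A B C : is_subgroup A -> is_subgroup B ->
  finite_index A B -> finite_index B C -> finite_index A C.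
Proof.
move=> sA sB /(finite_indexP _ sA)[F finF BF] /(finite_indexP _ sB)[E finE CE].
apply/(finite_indexP _ sA); exists [set (e * f)%g | e in E & f in F].
  exact: finite_image2.
move=> c /CE[e Ee /BF[f Ff Aef]]; exists (e * f)%g.
  by exists e => //; exists f.
by rewrite invgM -!mulgA in Aef *.
Qed.

Lemma finite_index_conj g A B : is_subgroup A ->
  finite_index A B -> finite_index (conj_set g A) (conj_set g B).
Proof.
move=> sA /(finite_indexP _ sA)[F finF BF].
apply/(finite_indexP _ (conj_set_subgroup g sA)); exists (conj_set g F).
  exact: finite_image.
move=> _ [b /BF[f Ff Afb] <-]; exists (g * f * g^-1)%g; first by exists f.
apply/conj_setP; move: Afb.
by rewrite !invgM invgK !mulgA !mulgVK mulVg mul1g.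
Qed.

(** In the coset decomposition of B along A, move the representatives into B;
    they then differ from the elements of B by elements of A and B. *)
Lemma finite_indexI A B : is_subgroup A -> is_subgroup B ->
  finite_index A B -> finite_index (A `&` B) B.
Proof.
move=> sA sB /(finite_indexP _ sA)[F finF BF].
apply/(finite_indexP _ (setI_subgroup sA sB)).
pose rep f := xget 1%g [set b | B b /\ A (f^-1 * b)%g].
exists [set rep f | f in F]; first exact: finite_image.
move=> b Bb; have [f Ff Afb] := BF b Bb; exists (rep f); first by exists f.
have [Br Ar] : [set b | B b /\ A (f^-1 * b)%g] (rep f).
  by apply: (@xgetPex _ 1%g); exists b.
split; last by case: sB => _; apply.
case: sA => _ /(_ _ _ Ar Afb).
by rewrite invgM invgK !mulgA mulgK.
Qed.

(** For g in A, conjugation by g fixes A, so g L g^-1 is commensurable with A,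
    hence with L. *)
Lemma commensurable_commensurator L A : is_subgroup A ->
  finite_index A [set` L] -> finite_index [set` L] A ->
  A `<=` commensurator L.
Proof.
move=> sA AL LA g Ag; have sL := groupClosed_is_subgroup L.
have sgL := conj_set_subgroup g sL.
have AgL : finite_index A (conj_set g [set` L]).
  by rewrite -{1}(conj_set_stable sA Ag); exact: finite_index_conj.
have gLA : finite_index (conj_set g [set` L]) A.
  by rewrite -{1}(conj_set_stable sA Ag); exact: finite_index_conj.
rewrite /commensurator /=; split.
  by apply: finite_indexI => //; exact: finite_index_trans AL.
by rewrite setIC; apply: finite_indexI => //; exact: finite_index_trans AgL.
Qed.

End commensurability.

(** * Invariant vectors and finite orbits *)

Section spectral_gap.
Variable R : realType.

Lemma trivial_weakly_contained (Gam : groupType) (pi : unitary_rep R Gam)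
    (w : rep_space pi) :
  w != 0 -> (forall g, pi g w = w) -> weakly_contained (trivial_rep R Gam) pi.
Proof.
move=> w0 fw; have nw : 0 < hnorm w.
  by rewrite lt_def hnorm_ge0 andbT; apply: contra_neq w0 => /hnorm_eq0.
pose U (z : rep_space (trivial_rep R Gam)) : rep_space pi :=
  (z * (hnorm w)^-1%:C%C) *: w.
have linU : linear U.
  by move=> c a b; rewrite /U scalerA -scalerDl mulrA -mulrDl.
pose ULin := GRing.isLinear.Build R[i] _ _ _ U linU.
pose U' : {linear rep_space (trivial_rep R Gam) -> rep_space pi} :=
  HB.pack U ULin.
apply: (@weakly_contained_isometry _ _ _ _ U') => [u|g u] /=.
  rewrite /U hnormZ normcM normc_real ?invr_ge0 ?hnorm_ge0// mulfVK ?gt_eqF//.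
  by rewrite /hnorm dnorm_CE /sqmod; case: (u).
by rewrite /U linearZ /= fw.
Qed.

(** Otherwise the nontrivial cosets of H inside A would form a finite
    H-invariant set, whose indicator is an invariant vector. *)
Lemma Sub_sg_finite_index (G : groupType) (H : groupClosed G) (A : set G) :
  Sub_sg R H -> is_subgroup A -> [set` H] `<=` A ->
  finite_index [set` H] A -> A `<=` [set` H].
Proof.
move=> gapH sA HA fHA l Al; apply: contrapT => /= Hl; apply: gapH.
pose S := [set C : nontrivial_cosets H |
  exists2 l, A l & val (val C) = left_translate l [set` H]].
have finS : finite_set S.
  apply: (@sub_finite_set _ _ ((fun C : nontrivial_cosets H => val (val C)) @^-1`
    [set left_translate b [set` H] | b in A])).
    by move=> C [k Ak Ck]; exists k.
  by apply: finite_preimage => // x y _ _ /val_inj/val_inj.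
have lH : is_left_coset H (left_translate l [set` H]) by apply/asboolP; exists l.
pose lC : cosets H := Sub _ lH.
have lN : val lC != [set` H].
  apply/eqP => /= lHH; apply: Hl; have : left_translate l [set` H] l.
    by exists 1%g; rewrite ?mulg1//= gpred1.
  by rewrite lHH.
pose lC' : nontrivial_cosets H := Sub lC lN.
pose w := indicator R finS.
apply: (@trivial_weakly_contained _
  (permutation_rep R (nontrivial_coset_action H)) w).
  apply/eqP => w0; have : w lC' = 0 by rewrite w0.
  rewrite indicatorE mem_set; last by exists l.
  by move/eqP; rewrite oner_eq0.
move=> h; apply: ell2_ext => C.
rewrite -[LHS]/(w (nontrivial_translate h^-1%g C)) !indicatorE.
congr (nat_of_bool _)%:R; apply/idP/idP => /set_mem [k Ak Ck]; apply/mem_set.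
  exists (val h * k)%g; first by apply: is_subgroupM => //; apply: HA; exact: valP.
  rewrite left_translateM -Ck /= -left_translateM.
  by rewrite -[(subgroup_val h * _)%g]/(val (h * h^-1)%g) mulgV left_translate1.
exists (val h^-1 * k)%g; last by rewrite left_translateM -Ck.
by apply: is_subgroupM => //; apply: HA; exact: valP.
Qed.

End spectral_gap.

(** * Conjugate subgroups *)

Section conjugate_subgroups.
Variables (R : realType) (G : groupType) (H L : groupClosed G) (g : G).
Hypothesis LgH : [set` L] = conj_set g [set` H].

Let right_translate (A : set G) : set G := [set (x * g)%g | x in A].

(** L g = g H, so right multiplication by g carries cosets of L to cosets of H. *)
Lemma right_translate_coset k :
  right_translate (left_translate k [set` L]) = left_translate (k * g)%g [set` H].
Proof.
rewrite LgH; apply/seteqP; split=> [_ [_ [_ [x Hx <-] <-] <-]|_ [x Hx <-]].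
  by exists x => //; rewrite !mulgA mulgVK.
exists (k * (g * x * g^-1))%g; last by rewrite !mulgA mulgVK.
by exists (g * x * g^-1)%g => //; exists x.
Qed.

Fact right_translate_subproof (B : cosets L) :
  is_left_coset H (right_translate (val B)).
Proof.
case: B => B /= /asboolP[k ->]; apply/asboolP; exists (k * g)%g.
exact: right_translate_coset.
Qed.

Let phi (B : cosets L) : cosets H := Sub _ (right_translate_subproof B).

Lemma phi_bij : set_bij [set: cosets L] [set: cosets H] phi.
Proof.
split=> //.
  move=> B C _ _ /(congr1 val) /= BC; apply: val_inj => /=.
  have rK A : [set (x * g^-1)%g | x in right_translate A] = A.
    apply/seteqP; split=> [_ [_ [x Ax <-] <-]|x Ax]; first by rewrite mulgK.
    by exists (x * g)%g; [exists x|rewrite mulgK].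
  by rewrite -(rK (val B)) BC rK.
move=> A _; case: (A) (valP A) => B pB /= /[dup] /asboolP[k Bk] _.
have kL : is_left_coset L (left_translate (k * g^-1)%g [set` L]).
  by apply/asboolP; exists (k * g^-1)%g.
exists (Sub _ kL : cosets L) => //; apply: val_inj => /=.
by rewrite right_translate_coset mulgVK Bk.
Qed.

Lemma phi_translate k B : phi (coset_translate k B) = coset_translate k (phi B).
Proof.
apply: val_inj => /=; apply/seteqP.
split=> [_ [_ [x Bx <-] <-]|_ [_ [x Bx <-] <-]].
  by exists (x * g)%g; [exists x|rewrite mulgA].
by exists (k * x)%g; [exists x|rewrite mulgA].
Qed.

Fact pullback_ell2 (f : ell2 R (cosets H)) :
  (fun B => f (phi B)) \in @ell2_pred R (cosets L).
Proof.
apply/asboolP; rewrite rsummableE.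
rewrite -(reindex_esum _ _ phi (fun x => `|sqmod (f x)|%:E) phi_bij).
exact: ell2P.
Qed.

Let pullback (f : rep_space (quasi_regular R H)) : rep_space (quasi_regular R L) :=
  Ell2 (pullback_ell2 f).

Fact pullback_linear : linear pullback.
Proof. by move=> c f f'; apply: ell2_ext. Qed.

HB.instance Definition _ := GRing.isLinear.Build R[i] _ _ _ pullback pullback_linear.

Lemma conj_set_weakly_contained :
  weakly_contained (quasi_regular R H) (quasi_regular R L).
Proof.
apply: (@weakly_contained_isometry _ _ _ _ pullback) => [f|k f].
  rewrite !hnorm_ell2E; congr (Num.sqrt (fine _)).
  by rewrite (reindex_esum _ _ phi (fun x => (sqmod (f x))%:E) phi_bij).
apply: ell2_ext => B.
rewrite -[LHS]/((f : ell2 _ _) (coset_translate k^-1%g (phi B))).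
by rewrite -phi_translate.
Qed.

End conjugate_subgroups.

(** * Commensurability from the transferred vector *)

Section transferred_vector.
Variables (R : realType) (G : groupType) (H L : groupClosed G).
Variable v : rep_space (quasi_regular R L).
Hypothesis Hv : forall h, [set` H] h -> quasi_regular R L h v = v.
Hypothesis vperp : forall g, ~ [set` H] g -> hdot _ (quasi_regular R L g v) v = 0.
Variable x : G.

Fact coset_subproof : is_left_coset L (left_translate x [set` L]).
Proof. by apply/asboolP; exists x. Qed.

Let A : cosets L := Sub _ coset_subproof.
Hypothesis vA : (v : ell2 R _) A != 0.

Lemma translateE g B :
  (quasi_regular R L g v : ell2 R _) B = (v : ell2 R _) (coset_translate g^-1%g B).
Proof. by []. Qed.

(** The vector is constant on the H-orbit of A, so square summability makes
    that orbit finite. *)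
Lemma fixed_finite_index : finite_index (conj_set x [set` L]) [set` H].
Proof.
pose S := [set B : cosets L | (v : ell2 R _) B = (v : ell2 R _) A].
apply: (@sub_finite_set _ _
  ((fun B : cosets L => [set (y * x^-1)%g | y in val B]) @` S)); last first.
  by apply: finite_image; exact: ell2_level_finite.
move=> _ [h Hh <-]; exists (coset_translate h A).
  have Hh' : [set` H] h^-1%g by rewrite /= gpredV.
  by rewrite /S /= -[h in LHS]invgK -translateE Hv.
apply/seteqP; split=> [_ [_ [_ [k Lk <-] <-] <-]|_ [_ [k Lk <-] <-]].
  by exists (x * k * x^-1)%g; [exists k|rewrite !mulgA].
by exists (h * (x * k))%g; [exists (x * k)%g => //; exists k|rewrite !mulgA].
Qed.

(** Elements of the stabiliser of A representing distinct cosets of H translate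
    the vector to pairwise orthogonal vectors with the same nonzero value at A;
    comparing the norm and the value at A of their sum bounds their number. *)
Lemma orthogonal_finite_index : finite_index [set` H] (conj_set x [set` L]).
Proof.
apply: (bounded_card_finite (c := sqmod ((v : ell2 R _) A))
  (M := hnorm v ^+ 2)); first exact: sqmod_gt0.
move=> B BS; pose reps C :=
  [set l | conj_set x [set` L] l /\ left_translate l [set` H] = C].
pose rep C := xget 1%g (reps C).
have repP C : C \in B -> reps C (rep C).
  move=> CB; have [l Ll lC] := BS C CB.
  by apply: (@xgetPex _ 1%g (reps C)); exists l.
pose y := \sum_(C <- B) quasi_regular R L (rep C) v.
have normy : hnorm y ^+ 2 = (#|` B|)%:R * hnorm v ^+ 2.
  rewrite hnorm_sqr_sum ?fset_uniq// => [|C D CB DB CD].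
    rewrite (eq_bigr (fun=> hnorm v ^+ 2)) => [|C _]; last by rewrite hnorm_rep.
    by rewrite big_const_seq count_predT iter_addr_0 mulr_natl.
  have [_ rC] := repP C CB; have [_ rD] := repP D DB.
  rewrite -(mulVKg (rep D) (rep C)) rep_opM rep_op_dot; apply: vperp => /= DC.
  by move/eqP: CD; apply; rewrite -rC -rD; apply/esym/left_translate_eqP.
have yA : (y : ell2 R _) A = (#|` B|)%:R * (v : ell2 R _) A.
  rewrite /y -[#|` B|](count_predT) mulr_natl -iter_addr_0 -big_const_seq.
  rewrite (big_morph (fun f : ell2 R (cosets L) => f A) (id1 := 0) (op1 := +%R))//.
  rewrite big_seq [RHS]big_seq; apply: eq_bigr => C /repP[[k Lk <-] _].
  rewrite translateE; congr (ell2_fun v _); apply: val_inj => /=.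
  rewrite -left_translateM !invgM invgK -!mulgA mulVg mulg1 left_translateM.
  by rewrite (left_translate_sub (H := L)) ?gpredV.
have := sqmod_le_hnorm (y : ell2 R _) A; rewrite yA normy.
have -> : sqmod ((#|` B|)%:R * (v : ell2 R _) A) =
    (#|` B|)%:R ^+ 2 * sqmod ((v : ell2 R _) A).
  rewrite -(rmorph_nat (real_complex R)); case: (ell2_fun v A) => a b.
  by rewrite /sqmod /=; ring.
have [->|B0] := posnP #|` B|; first by rewrite !mul0r sqr_ge0.
by rewrite expr2 -mulrA ler_pM2l// ltr0n.
Qed.

End transferred_vector.

Lemma conjugate_sym (G : groupType) (H L : groupClosed G) :
  conjugate L H -> conjugate H L.
Proof.
by move=> [g LH]; exists g^-1%g; rewrite LH conj_setM mulVg conj_set1.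
Qed.

Theorem theorem1 (R : realType) (G : groupType) (cG : countable [set: G])
    (H : groupClosed G) (hH : Sub_sg R H)
    (L : groupClosed G) (hL : self_commensurating L) :
  weakly_equivalent (quasi_regular R H) (quasi_regular R L) <-> conjugate L H.
Proof.
split=> [weq|LH]; last first.
  split; last have := conjugate_sym LH.
    by case: LH => g; exact: conj_set_weakly_contained.
  by case=> g; exact: conj_set_weakly_contained.
have [s [s1 sH [r [r0 r1 gap]]]] := Sub_sg_comb hH.
have [v [v0 Hv vperp]] := transfer_vector (H := [set` H]) weq
  (hnorm_base_vector R H) (@base_vector_fixed R G H)
  (fun g Hg => base_vector_orthogonal R (introN idP Hg)) sH s1 r0 r1 gap.
have [B vB] : exists B, (v : ell2 R _) B != 0.
  apply: contrapT => /forallNP nB; move/eqP: v0; apply; apply: ell2_ext => B.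
  by apply/eqP/negPn/negP/nB.
have [x Bx] : exists x, val B = left_translate x [set` L].
  by apply/asboolP; exact: valP B.
have vA : (v : ell2 R _) (Sub _ (coset_subproof L x)) != 0.
  by rewrite (_ : Sub _ _ = B)//; apply: val_inj.
have fLH := fixed_finite_index Hv vA.
have fHL := orthogonal_finite_index vperp vA.
have sH' := groupClosed_is_subgroup H; have sL := groupClosed_is_subgroup L.
have sLx := conj_set_subgroup x sL.
have HLx : [set` H] `<=` conj_set x [set` L].
  have sHx := conj_set_subgroup x^-1%g sH'.
  have := @commensurable_commensurator _ L (conj_set x^-1%g [set` H]) sHx.
  rewrite hL => HL h Hh; apply/conj_setP; apply: HL.
  - have := finite_index_conj x^-1%g sH' fHL.
    by rewrite conj_setM mulVg conj_set1.
  - have := finite_index_conj x^-1%g sLx fLH.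
    by rewrite conj_setM mulVg conj_set1.
  - by apply/conj_setP; rewrite invgK !mulgA mulgV mul1g mulgK.
have HE : [set` H] = conj_set x [set` L].
  by apply/seteqP; split => //; exact: Sub_sg_finite_index hH sLx HLx fHL.
by exists x^-1%g; rewrite HE conj_setM mulVg conj_set1.
Qed.
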